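(* Let $S_n$ be equipped with its set of Coxeter generators $\Sigma_n=\{(i,i+1)\}_{i=1}^{n-1}$. Both of the following hold. (1) (Relative combinatorial invariance for symmetric groups.) There is an assignment of a proper subset $\mathbb{J}(S_n)\subsetneq\Sigma_n$ to each $n\geq2$ with the following property. Let $\sigma_1,\omega_1\in W_1=S_{n_1}$ and $\sigma_2,\omega_2\in W_2=S_{n_2}$. Suppose there is an isomorphism $\phi$ of directed graphs from the Bruhat interval $G[\sigma_1,\omega_1]$ to the Bruhat interval $G[\sigma_2,\omega_2]$ such that for any edge $\sigma_1\leq z<tz\leq\omega_1$ of $G[\sigma_1,\omega_1]$ one has $t\in(W_1)_{\mathbb{J}(W_1)}$ if and only if $\phi(tz)\phi(z)^{-1}\in(W_2)_{\mathbb{J}(W_2)}$. Then $R_{\sigma_1,\omega_1,\mathbb{J}(W_1)}=R_{\sigma_2,\omega_2,\mathbb{J}(W_2)}$. (2) (Filtered combinatorial invariance for symmetric groups.) There is an assignment of a filtration $\underline{J}^0$ to each $(S_n,\Sigma_n)$ with the following property. Let $\sigma_1,\omega_1\in S_{n_1}$, $\sigma_2,\omega_2\in S_{n_2}$, and let $\alpha_1,\alpha_2$ be the reflection-coloring maps of the assigned filtrations of $S_{n_1}$ and $S_{n_2}$, with $r_1$ and $r_2$ colors respectively. Suppose there is an isomorphism $\phi$ of directed graphs from $G[\sigma_1,\omega_1]$ to $G[\sigma_2,\omega_2]$, and a strictly increasing map $\gamma:\{1,\ldots,r_1\}\to\{1,\ldots,r_2\}$ such that for any edge $\sigma_1\leq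 z<tz\leq\omega_1$ of $G[\sigma_1,\omega_1]$ the identity $\gamma(\alpha_1(t))=\alpha_2(t')$ holds, where $t'$ is the reflection with $\phi(tz)=t'\phi(z)$. Then $P_{\sigma_1,\omega_1}=P_{\sigma_2,\omega_2}$.
   Context: For a finite Coxeter system $(W,S)$, $\ell$ is the length, $\leq$ the Bruhat order, $T=\bigcup_{\omega\in W}\omega S\omega^{-1}$ the set of reflections, $\omega_0$ the longest element; for $J\subseteq S$, $W_J$ is the subgroup generated by $J$ and $\omega_0^J$ its longest element. The Bruhat interval $G[\sigma,\omega]$ is the directed graph with vertices all $z\in W$ with $\sigma\leq z\leq\omega$ and edges the pairs $(z_1,z_2)$ of vertices with $z_2z_1^{-1}\in T$ and $\ell(z_1)<\ell(z_2)$. An isomorphism of directed graphs is a bijection of vertices such that $(z,z')$ is an edge iff $(\phi(z),\phi(z'))$ is an edge. A filtration on $(W,S)$ is a chain $\emptyset=J_0\subsetneq J_1\subsetneq\cdots\subsetneq J_r=S$. Its reflection-coloring map $\alpha:T\to\{1,\ldots,r\}$ sends $t$ to the minimal $i$ with $t\in W_{J_i}$. $P_{\sigma,\omega}$ denotes the usual Kazhdan-Lusztig polynomial in $q=v^{-2}$. Let $\mathcal{L}=\mathbb{Z}[v,v^{-1}]$. The Hecke algebra $\mathcal{H}(W)$ is the $\mathcal{L}$-algebra with basis $\{h_\omega\}_{\omega\in W}$ and relations $h_{\omega_1}h_{\omega_2}=h_{\omega_1\omega_2}$ if $\ell(\omega_1)+\ell(\omega_2)=\ell(\omega_1\omega_2)$,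 and $(h_s+v)(h_s-v^{-1})=0$ for $s\in S$. For $\omega,\tau\in W$ put $f_{\omega,\tau}=h_\tau^{-1}h_{\tau\omega}$; for fixed $\tau$ these form a basis of $\mathcal{H}(W)$, with dual basis $\{f^{\omega,\tau}\}_{\omega\in W}$ of $\mathrm{Hom}_{\mathcal{L}}(\mathcal{H}(W),\mathcal{L})$. The $J$-relative $R$-polynomials are $R_{\sigma,\omega,J}=v^{\ell(\sigma)-\ell(\omega)}\langle f^{\sigma,\omega_0\omega_0^J},h_\omega\rangle\in\mathcal{L}$. *)

(* Defs.v *)
From HB Require Import structures.
From mathcomp Require Import all_boot all_order all_fingroup all_algebra.
From mathcomp Require Import boolp.
From mathcomp Require classical_sets.

Set Implicit Arguments.
Unset Strict Implicit.
Unset Printing Implicit Defensive.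

Import GRing.Theory.

(* In the definitions below [gT] is the whole Coxeter group W and
   [S : {set gT}] its set of Coxeter generators. *)

Section Coxeter.

Local Open Scope group_scope.
Local Open Scope nat_scope.

Variable gT : finGroupType.
Implicit Types (S J : {set gT}) (w z s o : gT).

(* [S ^+ k] is the k-fold product set, i.e. the elements represented by words
   of length k; a reduced word of an element of <<S>> has fewer than #|gT|
   letters, as its prefixes have pairwise distinct products. *)
Definition len S w : nat := find (fun k => w \in (S ^+ k)%g) (iota 0 #|gT|).

Definition reflections S : {set gT} := (\bigcup_(w : gT) S :^ w)%g.

Definition bruhat_edge S : rel gT :=
  [rel z1 z2 | ((z2 * z1^-1)%g \in reflections S) && (len S z1 < len S z2)].

Definition bruhat_le S : rel gT := connect (bruhat_edge S).

(* The longest element of the Coxeter system (<<J>>, J). *)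
Definition longest J : gT := [arg max_(w > 1%g in <<J>>%g) len J w].

Definition bruhat_interval S s o : Type :=
  {z : gT | bruhat_le S s z && bruhat_le S z o}.

Definition bruhat_interval_edge S s o : rel (bruhat_interval S s o) :=
  [rel z1 z2 | bruhat_edge S (val z1) (val z2)].

(* The t with z' = t z. *)
Definition edge_reflection S s o (z z' : bruhat_interval S s o) : gT :=
  (val z' * (val z)^-1)%g.

(* A filtration J_0 < J_1 < ... < J_r; the values of [filt_set] beyond
   [filt_size] are irrelevant. *)
Record filtration S := Filtration {
  filt_size : nat;
  filt_set : nat -> {set gT};
  filt_set0 : filt_set 0 = set0;
  filt_setT : filt_set filt_size = S;
  filt_proper : forall i, i < filt_size -> filt_set i \proper filt_set i.+1
}.

(* For t a reflection, the value lies in {1, ..., filt_size F}. *)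
Definition coloring S (F : filtration S) (t : gT) : nat :=
  find (fun i => t \in <<filt_set F i>>%g) (iota 0 (filt_size F).+1).

End Coxeter.

Definition digraph_iso (V1 V2 : Type) (e1 : rel V1) (e2 : rel V2)
    (phi : V1 -> V2) : Prop :=
  bijective phi /\ forall z z', e1 z z' = e2 (phi z) (phi z').

(* Products of permutations compose from left to right in MathComp.  This
   replaces ('S_n, Sigma n) by its opposite, to which it is isomorphic as a
   Coxeter system through inversion. *)
Definition Sigma n : {set 'S_n} :=
  [set tperm p.1 p.2 | p : 'I_n * 'I_n & p.1.+1 == p.2 :> nat].

Local Open Scope ring_scope.

(* Z[v, v^-1], as the subring of Frac(Z[v]) of fractions p / v^k.  The ring
   operations are locked, since unification must not unfold those of a field
   of fractions. *)
Section Laurent.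

Local Notation frac := {fraction {poly int}}.
Local Notation "p %:F" := (@FracField.tofrac _ p).

Definition laurent_pred : {pred frac} :=
  fun x => `[< exists (p : {poly int}) (k : nat), x = p%:F / 'X%:F ^+ k >].

Lemma laurentP (x : frac) :
  reflect (exists (p : {poly int}) (k : nat), x = p%:F / 'X%:F ^+ k)
    (x \in laurent_pred).
Proof. exact: asboolP. Qed.

Lemma fracX_neq0 k : ('X%:F : frac) ^+ k != 0.
Proof. by rewrite expf_neq0 // tofrac_eq0 polyX_eq0. Qed.

Fact laurent_pred_poly p : (p%:F : frac) \in laurent_pred.
Proof. by apply/laurentP; exists p, 0; rewrite expr0 divr1. Qed.

Fact laurent_predD (x y : frac) :
  x \in laurent_pred -> y \in laurent_pred -> x + y \in laurent_pred.
Proof.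
move=> /laurentP[p [k ->]] /laurentP[q [l ->]]; apply/laurentP.
exists (p * 'X^l + q * 'X^k), (k + l)%N.
rewrite tofracD !tofracM !tofracXn exprD mulrDl invfM; congr (_ + _).
  by rewrite mulrACA divff ?fracX_neq0 ?mulr1.
by rewrite [_^-1 * _]mulrC mulrACA divff ?fracX_neq0 ?mulr1.
Qed.

Fact laurent_predN (x : frac) : x \in laurent_pred -> - x \in laurent_pred.
Proof.
move=> /laurentP[p [k ->]]; apply/laurentP.
by exists (- p), k; rewrite tofracN mulNr.
Qed.

Fact laurent_predM (x y : frac) :
  x \in laurent_pred -> y \in laurent_pred -> x * y \in laurent_pred.
Proof.
move=> /laurentP[p [k ->]] /laurentP[q [l ->]]; apply/laurentP.
by exists (p * q), (k + l)%N; rewrite tofracM exprD invfM mulrACA.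
Qed.

Record laurent := MkLaurent {
  laurent_val : frac;
  laurent_valP : laurent_val \in laurent_pred
}.

End Laurent.

HB.instance Definition _ := [isSub for laurent_val].
HB.instance Definition _ := [Choice of laurent by <:].

HB.lock Definition laurent_poly (p : {poly int}) : laurent :=
  MkLaurent (laurent_pred_poly p).
HB.lock Definition laurent_add (x y : laurent) : laurent :=
  MkLaurent (laurent_predD (laurent_valP x) (laurent_valP y)).
HB.lock Definition laurent_opp (x : laurent) : laurent :=
  MkLaurent (laurent_predN (laurent_valP x)).
HB.lock Definition laurent_mul (x y : laurent) : laurent :=
  MkLaurent (laurent_predM (laurent_valP x) (laurent_valP y)).
HB.lock Definition laurent_inv (x : laurent) : laurent :=
  insubd x (laurent_val x)^-1.

Section LaurentRing.

Local Notation "p %:F" := (@FracField.tofrac _ p).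
Local Notation val := laurent_val.
Local Notation zero := (laurent_poly 0).
Local Notation one := (laurent_poly 1).

Lemma laurent_val_inj : injective val. Proof. exact: val_inj. Qed.

Lemma laurent_val_poly p : val (laurent_poly p) = p%:F.
Proof. by rewrite laurent_poly.unlock. Qed.
Lemma laurent_val_add x y : val (laurent_add x y) = val x + val y.
Proof. by rewrite laurent_add.unlock. Qed.
Lemma laurent_val_opp x : val (laurent_opp x) = - val x.
Proof. by rewrite laurent_opp.unlock. Qed.
Lemma laurent_val_mul x y : val (laurent_mul x y) = val x * val y.
Proof. by rewrite laurent_mul.unlock. Qed.
Lemma laurent_val_inv x : (val x)^-1 \in laurent_pred ->
  val (laurent_inv x) = (val x)^-1.
Proof. by move=> xV; rewrite laurent_inv.unlock; apply: insubdK. Qed.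

Let valE := (laurent_val_poly, laurent_val_add, laurent_val_opp,
  laurent_val_mul, tofrac0, tofrac1).

Fact laurent_addA : associative laurent_add.
Proof. by move=> x y z; apply: laurent_val_inj; rewrite !valE addrA. Qed.
Fact laurent_addC : commutative laurent_add.
Proof. by move=> x y; apply: laurent_val_inj; rewrite !valE addrC. Qed.
Fact laurent_add0 : left_id zero laurent_add.
Proof. by move=> x; apply: laurent_val_inj; rewrite !valE add0r. Qed.
Fact laurent_addN : left_inverse zero laurent_opp laurent_add.
Proof. by move=> x; apply: laurent_val_inj; rewrite !valE addNr. Qed.
Fact laurent_mulA : associative laurent_mul.
Proof. by move=> x y z; apply: laurent_val_inj; rewrite !valE mulrA. Qed.
Fact laurent_mulC : commutative laurent_mul.
Proof. by move=> x y; apply: laurent_val_inj; rewrite !valE mulrC. Qed.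
Fact laurent_mul1 : left_id one laurent_mul.
Proof. by move=> x; apply: laurent_val_inj; rewrite !valE mul1r. Qed.
Fact laurent_mulD : left_distributive laurent_mul laurent_add.
Proof. by move=> x y z; apply: laurent_val_inj; rewrite !valE mulrDl. Qed.
Fact laurent_1neq0 : one != zero.
Proof.
apply/eqP => /(congr1 val); rewrite !valE => /eqP; apply/negP.
exact: oner_neq0.
Qed.

HB.instance Definition _ := GRing.isZmodule.Build laurent
  laurent_addA laurent_addC laurent_add0 laurent_addN.
HB.instance Definition _ := GRing.Zmodule_isComNzRing.Build laurent
  laurent_mulA laurent_mulC laurent_mul1 laurent_mulD laurent_1neq0.

Lemma laurent_val0 : val 0 = 0.
Proof. exact: etrans (laurent_val_poly 0) (tofrac0 _). Qed.
Lemma laurent_val1 : val 1 = 1.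
Proof. exact: etrans (laurent_val_poly 1) (tofrac1 _). Qed.
Lemma laurent_valM : {morph val : x y / x * y}.
Proof. exact: laurent_val_mul. Qed.
Lemma laurent_val_eq0 x : (val x == 0) = (x == 0).
Proof.
apply/eqP/eqP => [x0|->]; last exact: laurent_val0.
by apply: laurent_val_inj; rewrite x0 laurent_val0.
Qed.

Definition laurent_unit : {pred laurent} :=
  fun x => (x != 0) && ((val x)^-1 \in laurent_pred).

Fact laurent_mulVx : {in laurent_unit, left_inverse 1 laurent_inv *%R}.
Proof.
move=> x /andP[x0 xV]; apply: laurent_val_inj.
by rewrite laurent_valM laurent_val1 laurent_val_inv // mulVf // laurent_val_eq0.
Qed.

Fact laurent_unitPl (x y : laurent) : y * x = 1 -> laurent_unit x.
Proof.
move=> yx; have yx' : val y * val x = 1 by rewrite -laurent_valM yx laurent_val1.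
have x0 : val x != 0.
  by apply: contra_eq_neq yx' => ->; rewrite mulr0 eq_sym oner_neq0.
apply/andP; split; first by rewrite -laurent_val_eq0.
suff -> : (val x)^-1 = val y by exact: laurent_valP.
by rewrite -[LHS]mul1r -yx' mulfK.
Qed.

Fact laurent_inv_out : {in [predC laurent_unit], laurent_inv =1 id}.
Proof.
move=> x; rewrite inE /= negb_and negbK => /orP[/eqP-> | xV].
  apply: laurent_val_inj; rewrite laurent_val_inv laurent_val0 invr0 //.
  by rewrite -laurent_val0; exact: laurent_valP.
by rewrite laurent_inv.unlock /insubd insubN.
Qed.

HB.instance Definition _ := GRing.ComNzRing_hasMulInverse.Build laurent
  laurent_mulVx laurent_unitPl laurent_inv_out.

Fact laurent_idomain (x y : laurent) : x * y = 0 -> (x == 0) || (y == 0).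
Proof.
move=> /(congr1 val); rewrite laurent_valM laurent_val0 => /eqP.
by rewrite mulf_eq0 !laurent_val_eq0.
Qed.

HB.instance Definition _ :=
  GRing.ComUnitRing_isIntegral.Build laurent laurent_idomain.

Definition v : laurent := laurent_poly 'X.

Lemma v_unit : v \is a GRing.unit.
Proof.
apply/andP; rewrite -laurent_val_eq0 laurent_val_poly tofrac_eq0 polyX_eq0.
split=> //; apply/laurentP; exists 1, 1; by rewrite tofrac1 mul1r expr1.
Qed.

End LaurentRing.

(* The Hecke algebra is characterized by its basis and relations.  Its carrier
   is an algebra with an inverse function, total as always in MathComp; every
   [hecke_h w] is invertible. *)
Record heckeAlgebra (gT : finGroupType) (S : {set gT}) := HeckeAlgebra {
  hecke_carrier :> unitAlgType laurent;
  hecke_h : gT -> hecke_carrier;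
  hecke_basis : forall x : hecke_carrier,
    exists! c : {ffun gT -> laurent}, x = \sum_(w : gT) c w *: hecke_h w;
  hecke_mul : forall w1 w2 : gT,
    (len S w1 + len S w2)%N = len S (w1 * w2)%g ->
    hecke_h w1 * hecke_h w2 = hecke_h (w1 * w2)%g;
  hecke_quadratic : forall s : gT, s \in S ->
    (hecke_h s + v%:A) * (hecke_h s - v^-1%:A) = 0
}.

Section Hecke.

Variables (gT : finGroupType) (S : {set gT}) (H : heckeAlgebra S).
Implicit Types (J : {set gT}) (w s o tau : gT).

Local Notation h := (@hecke_h gT S H).
Local Notation l := (len S).

Definition hecke_f w tau : H := (h tau)^-1 * h (tau * w)%g.

(* The value at x of the member of index s of the basis dual to b, that is the
   coefficient of x at [b s] (it is 0 if x has no expansion in b). *)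
Definition dual_basis (b : gT -> H) s (x : H) : laurent :=
  (classical_sets.xget (0 : {ffun gT -> laurent})
     (fun c => x = \sum_(w : gT) c w *: b w)) s.

Definition Rpoly J s o : laurent :=
  v ^ ((l s)%:Z - (l o)%:Z) *
  dual_basis (hecke_f^~ (longest S * longest J)%g) s (h o).

(* The canonical basis element attached to o by a family P of polynomials in
   q = v^-2. *)
Definition KL_element (P : gT -> gT -> {poly int}) o : H :=
  \sum_(s : gT)
    (v ^ ((l o)%:Z - (l s)%:Z) * (map_poly intr (P s o)).[v ^- 2]) *: h s.

(* The unique ring homomorphism satisfying this is the bar involution. *)
Definition is_bar (bar : {rmorphism H -> H}) : Prop :=
  bar v%:A = v^-1%:A /\ forall w, bar (h w) = (h w^-1%g)^-1.

(* [P s o] is the Kazhdan-Lusztig polynomial P_{s,o}, in the variable q: there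
   is exactly one such family.  In the third clause
   (size (P s o)).-1 is the degree of P s o. *)
Definition is_KL_family (P : gT -> gT -> {poly int}) : Prop :=
  [/\ forall s o, ~~ bruhat_le S s o -> P s o = 0,
      forall o, P o o = 1,
      forall s o, bruhat_le S s o -> s != o ->
        (2 * (size (P s o)).-1 < l o - l s)%N
    & exists2 bar : {rmorphism H -> H},
        is_bar bar & forall o, bar (KL_element P o) = KL_element P o].

End Hecke.

(* Main.v *)
From HB Require Import structures.
Require Import Defs.
From mathcomp Require Import all_boot all_order all_fingroup all_algebra.
From mathcomp Require Import zify.

(* Colour the transposition (a b), a < b, by b: the filtration is
   {s_1} < {s_1, s_2} < ... and J(S_n) is its last proper member, so that a
   reflection is outside W_J iff it is (a n) for some a.

   Products compose from left to right, so (a b) w is w with its values at the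
   positions a and b exchanged, and w -> (a b) w is an edge iff w a < w b.
   Order the transpositions (a b), a < b, by b and then by a.  Multiplying h_w
   by h_u along a reduced word of u whose inversions form a final segment of this
   order expands h_u h_w as a sum over the increasing paths of the Bruhat graph
   with labels in that segment, a path of length k having weight
   (v^-1 - v)^k.  For u = w_0 w_0^J this is the relative R-polynomial, for
   u = w_0 it is the full one.

   Whether a path is increasing can be seen on the coloured graph: two
   consecutive edges x -> y -> z of the same colour carry increasing labels iff
   there is y' <> y with x -> y' of that colour and y' -> z (lo_lt_diamond).
   Since length differences are the lengths of the longest paths, the
   R-polynomials are invariants of the coloured graph; Kazhdan-Lusztig
   polynomials are then determined by the recursion expressing the
   bar-invariance of the canonical basis. *)

Set Implicit Arguments.
Unset Strict Implicit.
Unset Printing Implicit Defensive.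

Import GRing.Theory.

(** * Inversions of a permutation and their change under transpositions *)

Section Inversions.

Variable n : nat.
Implicit Types (w x y z : 'S_n) (a b c i j : 'I_n) (p : 'I_n * 'I_n).

Definition inversions w : {set 'I_n * 'I_n} :=
  [set p : 'I_n * 'I_n | (p.1 < p.2) && (w p.2 < w p.1)].

Definition ninv w : nat := #|inversions w|.

Lemma perm_leqNlt w i j : i != j -> (w i < w j) = ~~ (w j < w i).
Proof.
move=> ij; rewrite -leqNgt ltn_neqAle andb_idl // => _.
by apply: contra ij => /eqP/val_inj/perm_inj ->.
Qed.

(* An involution of the pairs i < j carrying the inversions of w to inversions of
   (a b) w other than (a, b), when w a < w b. *)
Definition tswap a b p :=
  let t := tperm a b in if t p.1 < t p.2 then (t p.1, t p.2) else p.

Lemma tswapK a b p : p.1 < p.2 -> tswap a b (tswap a b p) = p.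
Proof.
case: p => i j /= ij; rewrite /tswap /=.
by case: (boolP (tperm a b i < tperm a b j)) => /= tij; rewrite ?(negPf tij) // !tpermK ij.
Qed.

Lemma tswap_lt a b p : p.1 < p.2 -> (tswap a b p).1 < (tswap a b p).2.
Proof. by rewrite /tswap; case: ifP. Qed.

Lemma tswap_inj a b (A : {set 'I_n * 'I_n}) :
  {in A, forall p, p.1 < p.2} -> {in A &, injective (tswap a b)}.
Proof.
by move=> lA p q pA qA /(congr1 (tswap a b)); rewrite !tswapK ?lA.
Qed.

Lemma tswap_inversion a b w p : a < b -> w a < w b ->
  p \in inversions w ->
  tswap a b p \in inversions (tperm a b * w)%g :\ (a, b).
Proof.
move=> ab wab; rewrite !inE; case: p => i j /= /andP[ij wji].
rewrite tswap_lt // andTb /tswap /=; case: ifP => tij /=.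
  rewrite !permM !tpermK wji andbT.
  apply/negP => /eqP[] /(congr1 (tperm a b)); rewrite tpermK tpermL => ib.
  move=> /(congr1 (tperm a b)); rewrite tpermK tpermR => ja.
  by move: ij; rewrite ib ja ltnNge ltnW.
apply/andP; split.
  by apply/negP => /eqP[ia jb]; move: wji; rewrite ia jb ltnNge ltnW.
rewrite !permM; move: tij.
by case: tpermP => [?|?|_ _]; case: tpermP => [?|?|_ _] ?; subst; lia.
Qed.

(** [tswap a b] injects the inversions of [w] into those of [(a b) w] other than [(a, b)], and
    [(a, b)] is a new one. *)
Lemma ninv_tperm_lt a b w : a < b -> w a < w b ->
  ninv w < ninv (tperm a b * w)%g.
Proof.
move=> ab wab.
have lA : {in inversions w, forall p, p.1 < p.2}.
  by move=> p; rewrite inE => /andP[].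
rewrite /ninv [X in _ < X](cardsD1 (a, b)) [_ \in _]inE /= ab /=.
rewrite !permM tpermL tpermR wab add1n ltnS.
rewrite -(card_in_imset (@tswap_inj a b _ lA)).
by apply/subset_leq_card/subsetP => _ /imsetP[p pA ->]; apply: tswap_inversion.
Qed.

(** Here [tswap a b] also injects in the other direction: it could only miss the inversions of [w]
    at the pairs [(a, c)] and [(c, b)] with [a < c < b], where the hypothesis on [w c] decides. *)
Lemma ninv_tperm_cover a b w : a < b -> w a < w b ->
  (forall c, a < c < b -> ~~ (w a < w c < w b)) ->
  ninv (tperm a b * w)%g = (ninv w).+1.
Proof.
move=> ab wab nbetween; apply/eqP; rewrite eqn_leq ninv_tperm_lt // andbT.
rewrite /ninv [X in X <= _](cardsD1 (a, b)) [_ \in _]inE /= ab /=.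
rewrite !permM tpermL tpermR wab add1n ltnS.
set B := _ :\ _.
have lB : {in B, forall p, p.1 < p.2}.
  by move=> p; rewrite !inE => /and3P[].
rewrite -(card_in_imset (@tswap_inj a b _ lB)).
apply/subset_leq_card/subsetP => _ /imsetP[[i j] pB ->]; move: pB.
rewrite !inE /= => /and3P[ijab ij]; rewrite !permM => wji.
rewrite tswap_lt // /tswap /=; case: ifP => //= tij.
move: tij wji ijab; case: tpermP => [?|?|_ ib]; case: tpermP => [?|?|ja _] tij;
  subst => //; rewrite ?eqxx //; try lia.
- move=> wjb _; have jb : val j != b by apply: contraTneq wjb => /val_inj->; lia.
  rewrite (perm_leqNlt w (i := j) (j := a)); last exact/eqP.
  by have := nbetween j; rewrite ij; move: jb => /=; lia.
- move=> wai _; have ia : val i != a by apply: contraTneq wai => /val_inj->; lia.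
  rewrite (perm_leqNlt w (i := b) (j := i)); last by rewrite eq_sym; apply/eqP.
  by have := nbetween i; rewrite ij; move: ia => /=; lia.
Qed.

Lemma ninv_tperm a b w : a < b ->
  (ninv w < ninv (tperm a b * w)%g) = (w a < w b).
Proof.
move=> ab; apply/idP/idP; last exact: ninv_tperm_lt.
rewrite perm_leqNlt; last by rewrite neq_ltn ab.
apply: contraL => wba; rewrite -leqNgt ltnW //.
have := @ninv_tperm_lt a b (tperm a b * w)%g ab.
by rewrite tpermKg !permM tpermL tpermR; apply.
Qed.

Lemma ninv_tpermN a b w : a < b ->
  (ninv (tperm a b * w)%g < ninv w) = (w b < w a).
Proof.
move=> ab; have := ninv_tperm (tperm a b * w) ab.
by rewrite tpermKg !permM tpermL tpermR.
Qed.

Lemma ninv_adjacent a b w : a.+1 = b -> w a < w b ->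
  ninv (tperm a b * w)%g = (ninv w).+1.
Proof. by move=> ab wab; apply: ninv_tperm_cover => // [|c]; lia. Qed.

Lemma ninv_adjacentN a b w : a.+1 = b -> w b < w a ->
  ninv w = (ninv (tperm a b * w)%g).+1.
Proof.
move=> ab wba; have := @ninv_adjacent a b (tperm a b * w) ab.
by rewrite tpermKg !permM tpermL tpermR; apply.
Qed.

Lemma ninv_adjacent_le a b w : a.+1 = b -> ninv (tperm a b * w)%g <= (ninv w).+1.
Proof.
move=> ab; case: (boolP (w a < w b)) => [/(ninv_adjacent ab)-> //|].
by rewrite -perm_leqNlt => [/(ninv_adjacentN ab)->|]; rewrite -?(inj_eq val_inj) /=; lia.
Qed.

(** Increase at adjacent positions forces [i <= w i], and both sides have the same sum over all
    [i]. *)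
Lemma perm_no_descent w :
  (forall a b, a.+1 = b -> w a < w b) -> w = 1%g.
Proof.
move=> incr; have lew i : i <= w i.
  case: i => k; elim: k => // k IHk kn /=.
  by apply: leq_ltn_trans (IHk (ltnW kn)) _; apply: incr.
have eqw := leqif_sum (fun i (_ : true) => leqif_eq (lew i)).
have /eqP : \sum_(i < n) i = \sum_(i < n) w i by rewrite (reindex_inj (@perm_inj _ w)).
rewrite eqw.2 => /forallP/= eqi; apply/permP => i; rewrite perm1; apply/val_inj.
by rewrite /= -(eqP (eqi i)).
Qed.

End Inversions.

(** Evaluates the searches by which [len] and [coloring] are defined. *)
Lemma find_iota (p : pred nat) k N :
  k < N -> p k -> (forall j, j < k -> ~~ p j) -> find p (iota 0 N) = k.
Proof.
move=> kN pk npj; rewrite -(subnKC (ltnW kN)) iotaD find_cat size_iota add0n.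
rewrite (_ : has _ _ = false); last first.
  by apply/hasPn => j; rewrite mem_iota add0n => /andP[_ /npj].
by rewrite -(subnSK kN) /= pk addn0.
Qed.

(** * Standard parabolic subgroups: length and longest element *)

Section Simples.

Variable n : nat.
Implicit Types (w x y z : 'S_n) (a b c i j : 'I_n) (p : 'I_n * 'I_n).

(** Positions are counted from 0: these generate the copy of S_m moving only the first [m]
    positions, and [simples 1] is empty. *)
Definition simples m : {set 'S_n} :=
  [set tperm p.1 p.2 | p : 'I_n * 'I_n & (p.1.+1 == p.2 :> nat) && (p.2 < m)].

Definition fixes_above m w := forall i, m <= i -> w i = i.

Lemma simplesP m w :
  reflect (exists a b, [/\ a.+1 = b, b < m & w = tperm a b]) (w \in simples m).
Proof.
apply: (iffP imsetP) => [[[a b]]|[a [b [ab bm ->]]]].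
  by rewrite inE /= => /andP[/eqP ab bm] ->; exists a, b.
by exists (a, b); rewrite // inE /= ab eqxx.
Qed.

Lemma simples_full : simples n = Sigma n.
Proof.
apply/setP => w; apply/imsetP/imsetP => -[p]; rewrite !inE => pS ->; exists p => //.
  by case/andP: pS; rewrite inE.
by rewrite inE pS ltn_ord.
Qed.

Lemma simples_sub m : simples m \subset Sigma n.
Proof.
rewrite -simples_full; apply/subsetP => w /simplesP[a [b [ab _ ->]]].
by apply/simplesP; exists a, b.
Qed.

Lemma fixes_above_full w : fixes_above n w.
Proof. by move=> i; rewrite leqNgt ltn_ord. Qed.

Lemma fixes_above_lt m w i : fixes_above m w -> i < m -> w i < m.
Proof.
move=> wm im; rewrite ltnNge; apply/negP => mwi; have /perm_inj wi := wm _ mwi.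
by move: mwi; rewrite wi leqNgt im.
Qed.

Lemma fixes_above_descent m w : fixes_above m w -> w != 1%g ->
  exists a b, [/\ a.+1 = b, b < m & w b < w a].
Proof.
move=> wm w1; have [/existsP[a /existsP[b /andP[/eqP ab wba]]]|nd] :=
  boolP [exists a : 'I_n, exists b : 'I_n, (a.+1 == b) && (w b < w a)].
  exists a, b; split=> //; rewrite ltnNge; apply/negP => mb.
  case: (leqP m a) => [ma|am].
    by move: wba; rewrite !wm //; lia.
  by have := fixes_above_lt wm am; rewrite (wm b mb) in wba; lia.
case/negP: w1; apply/eqP/perm_no_descent => a b ab.
rewrite perm_leqNlt; last by rewrite -(inj_eq val_inj) /=; lia.
apply: contraNN nd => wba; apply/existsP; exists a; apply/existsP; exists b.
by rewrite ab eqxx.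
Qed.

Lemma fixes_above_mul m x y :
  fixes_above m x -> fixes_above m y -> fixes_above m (x * y)%g.
Proof. by move=> xm ym i mi; rewrite permM xm ?ym. Qed.

Lemma fixes_above_simple m w : w \in simples m -> fixes_above m w.
Proof.
by case/simplesP => a [b [ab bm ->]] i mi; rewrite tpermD // -(inj_eq val_inj) /=; lia.
Qed.

(** Multiplying away a descent lowers [ninv] by one, and all descents of [w] lie within the first
    [m] positions. *)
Lemma mem_simples_word m w : fixes_above m w -> w \in (simples m ^+ ninv w)%g.
Proof.
move=> wm; move wk: (ninv w) => k; elim: k w wm wk => [|k IHk] w wm wk.
  rewrite expg0; apply/set1P/eqP; apply: contraT => w1.
  have [a [b [ab _ wba]]] := fixes_above_descent wm w1.
  by rewrite (ninv_adjacentN ab wba) in wk.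
have w1 : w != 1%g.
  apply: contra_eq_neq wk => ->; rewrite /ninv (_ : inversions _ = set0) ?cards0 //.
  by apply/setP => p; rewrite !inE !perm1; lia.
have [a [b [ab bm wba]]] := fixes_above_descent wm w1.
have sm : tperm a b \in simples m by apply/simplesP; exists a, b.
have wk' := ninv_adjacentN ab wba; rewrite wk in wk'; case: wk' => wk'.
rewrite expgS; apply/mulsgP; exists (tperm a b) (tperm a b * w)%g => //.
  by apply: IHk => //; apply/fixes_above_mul/wm/fixes_above_simple.
by rewrite tpermKg.
Qed.

Lemma ninv_word_le w k : w \in (Sigma n ^+ k)%g -> ninv w <= k.
Proof.
elim: k w => [|k IHk] w.
  rewrite expg0 => /set1P->; rewrite /ninv leqn0 cards_eq0.
  by apply/eqP/setP => p; rewrite !inE !perm1; lia.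
rewrite expgS => /mulsgP[s x]; rewrite -simples_full => /simplesP[a [b [ab _ ->]]].
by rewrite simples_full => /IHk xk ->; apply: leq_trans (ninv_adjacent_le _ ab) _.
Qed.

(** This keeps the length within the range searched by [len]: there are 0 + 1 + ... + (n - 1) pairs,
    fewer than n!. *)
Lemma ninv_lt_card w : ninv w < #|'S_n|.
Proof.
rewrite card_Sn; apply: (@leq_ltn_trans (\sum_(j < n) j)).
  apply: (@leq_trans #|[set p : 'I_n * 'I_n | p.1 < p.2]|).
    by apply/subset_leq_card/subsetP => p; rewrite !inE => /andP[].
  rewrite -sum1_card (eq_bigl (fun p : 'I_n * 'I_n => true && (p.1 < p.2))).
    rewrite -(pair_big_dep xpredT (fun i j : 'I_n => i < j) (fun _ _ => 1)) /=.
    rewrite (exchange_big_dep xpredT) //=; apply: leq_sum => j _.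
    by rewrite (big_ord_narrow (ltnW (ltn_ord j))) sum1_card card_ord.
  by move=> p; rewrite inE.
elim: n => [|k IHk]; first by rewrite big_ord0.
by rewrite big_ord_recr factS /= mulSn -addSn leq_add // leq_pmulr // fact_gt0.
Qed.

Lemma len_simples m w : fixes_above m w -> len (simples m) w = ninv w.
Proof.
move=> wm; apply: find_iota; rewrite ?ninv_lt_card ?mem_simples_word // => j jk.
apply: contraL jk => wj; rewrite -leqNgt; apply: ninv_word_le.
apply: subsetP wj; elim: j => // j IHj.
by rewrite !expgS mulgSS ?simples_sub.
Qed.

Lemma len_Sigma w : len (Sigma n) w = ninv w.
Proof. by rewrite -simples_full len_simples //; apply: fixes_above_full. Qed.

Lemma mem_gen_simples m w : reflect (fixes_above m w) (w \in <<simples m>>%g).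
Proof.
apply: (iffP idP) => [|wm].
  pose X := [set i : 'I_n | m <= i].
  suff /subsetP sub : <<simples m>>%g \subset 'C(X | 'P)%g.
    by move/sub/astabP => wX i mi; have := wX i; rewrite inE; apply.
  rewrite gen_subG; apply/subsetP => s sm; apply/astabP => i.
  by rewrite inE => /(fixes_above_simple sm).
have : w \in (simples m ^+ ninv w)%g by apply: mem_simples_word.
move: (ninv w) => k; elim: k w {wm} => [|k IHk] x; first by rewrite expg0 => /set1P->; rewrite group1.
rewrite expgS => /mulsgP[s y sm /IHk ym ->].
exact: groupM (mem_gen sm) ym.
Qed.

Lemma fixes_above_inversions m w p :
  fixes_above m w -> p \in inversions w -> p.2 < m.
Proof.
move=> wm; rewrite inE [p.2 < m]ltnNge => /andP[p12 wp]; apply/negP => mp.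
rewrite (wm _ mp) in wp; case: (leqP m p.1) => [mp1|p1m].
  by move: wp; rewrite wm //; lia.
by have := fixes_above_lt wm p1m; lia.
Qed.

(** The reversal of the first [m] positions. The minimum with [n] keeps the value in range for all
    [m], so the default of [insubd] is never taken. *)
Definition rev_fun m i : 'I_n :=
  insubd i (if i < m then (minn m n).-1 - i else i).

Lemma rev_funE m i : rev_fun m i = (if i < m then (minn m n).-1 - i else i) :> nat.
Proof. by rewrite val_insubd; have := ltn_ord i; do 2!case: ifP; lia. Qed.

Lemma rev_funK m : involutive (rev_fun m).
Proof.
move=> i; apply/val_inj => /=; have := ltn_ord i.
by rewrite !rev_funE; do 2!case: ifP; lia.
Qed.

Definition rev_perm m : 'S_n := perm (inv_inj (@rev_funK m)).

Lemma rev_permE m i : rev_perm m i = (if i < m then (minn m n).-1 - i else i) :> nat.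
Proof. by rewrite permE rev_funE. Qed.

Lemma fixes_above_rev m : fixes_above m (rev_perm m).
Proof. by move=> i mi; apply/val_inj; rewrite /= rev_permE ltnNge mi. Qed.

Lemma rev_permV m : (rev_perm m)^-1%g = rev_perm m.
Proof.
by apply/permP => i; apply: (@perm_inj _ (rev_perm m)); rewrite permKV !permE rev_funK.
Qed.

(** [rev_perm m] inverts every pair below [m], hence every pair that [w] can invert. Equal inversion
    sets leave [rev_perm m * w] without descents. *)
Lemma ninv_max m w :
  fixes_above m w -> ninv (rev_perm m) <= ninv w -> w = rev_perm m.
Proof.
move=> wm inv_le; have rm := @fixes_above_rev m.
have sub : inversions w \subset inversions (rev_perm m).
  apply/subsetP => p pw; have p2m := fixes_above_inversions wm pw; move: pw.
  rewrite !inE => /andP[p12 _]; have := ltn_ord p.2; rewrite p12 /= !rev_permE.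
  by do 2!case: ifP; lia.
have /eqP eqI : inversions w == inversions (rev_perm m) by rewrite eqEcard sub.
suff E : (rev_perm m * w = 1)%g.
  by rewrite -[w](mulKg (rev_perm m)) E mulg1 rev_permV.
apply: perm_no_descent => a b ab; rewrite !permM.
case: (leqP m b) => [mb|bm].
  have mrb : m <= rev_perm m b by rewrite fixes_above_rev.
  case: (leqP m a) => [ma|am].
    by rewrite !fixes_above_rev // (wm _ ma) (wm _ mb) -ab.
  have := fixes_above_lt wm (fixes_above_lt rm am).
  by rewrite (rm _ mb) (wm _ mb); lia.
have : (rev_perm m b, rev_perm m a) \in inversions w.
  have rK i : rev_perm m (rev_perm m i) = i by rewrite !permE rev_funK.
  rewrite eqI inE /= !rK.
  by have := ltn_ord b; rewrite !rev_permE; do 2!case: ifP; lia.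
by rewrite inE /= => /andP[].
Qed.

Lemma longest_simples m : longest (simples m) = rev_perm m.
Proof.
rewrite /longest; case: arg_maxnP => [|w /mem_gen_simples wm wmax]; first exact: group1.
have rm := @fixes_above_rev m.
have := wmax _ (introT (mem_gen_simples _ _) rm).
by rewrite !len_simples // => /(ninv_max wm).
Qed.

End Simples.

(** * Edges and covers of the Bruhat graph *)

Section Edges.

Variable n : nat.
Implicit Types (w x y z t : 'S_n) (a b c i j : 'I_n).

Lemma reflectionsP t :
  reflect (exists a b, a < b /\ t = tperm a b) (t \in reflections (Sigma n)).
Proof.
apply: (iffP bigcupP) => [[w _]|[a [b [ab ->]]]].
  rewrite mem_conjg -simples_full => /simplesP[a [b [ab _ tw]]].
  have -> : t = tperm (w a) (w b).
    by rewrite -tpermJ -tw conjgKV.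
  case: (ltngtP (w a) (w b)) => [lt|lt|/val_inj/perm_inj E]; last by move: ab; rewrite E; lia.
    by exists (w a), (w b).
  by exists (w b), (w a); rewrite tpermC.
have a'n : a.+1 < n by have := ltn_ord b; lia.
pose a' := Ordinal a'n.
(* Conjugation by [(a' b)] takes [(a b)] to the simple transposition [(a a')]. *)
exists (tperm a' b) => //; rewrite mem_conjg -simples_full; apply/simplesP.
exists a, a'; split => //; rewrite tpermV tpermJ tpermR tpermD // eq_sym.
- by rewrite -(inj_eq val_inj) /=; lia.
- by rewrite -(inj_eq val_inj) /=; lia.
Qed.

Local Notation edge := (bruhat_edge (Sigma n)).
Local Notation le := (bruhat_le (Sigma n)).

Lemma edgeP x y :
  reflect (exists a b, [/\ a < b, x a < x b & y = tperm a b * x]%g) (edge x y).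
Proof.
rewrite /bruhat_edge /= !len_Sigma; apply: (iffP andP) => [[/reflectionsP[a [b [ab yx]]]]|].
  have -> : y = (tperm a b * x)%g by rewrite -yx mulgKV.
  by rewrite ninv_tperm // => xab; exists a, b.
case=> a [b [ab xab ->]]; rewrite mulgK ninv_tperm_lt //; split=> //.
by apply/reflectionsP; exists a, b.
Qed.

Lemma edge_tperm a b x : a < b -> edge x (tperm a b * x)%g = (x a < x b).
Proof.
move=> ab; rewrite /bruhat_edge /= !len_Sigma mulgK ninv_tperm //.
by apply: andb_idl => _; apply/reflectionsP; exists a, b.
Qed.

Lemma edge_ninv x y : edge x y -> ninv x < ninv y.
Proof. by rewrite /bruhat_edge /= !len_Sigma => /andP[]. Qed.

Lemma le_ninv x y : le x y -> ninv x <= ninv y.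
Proof.
case/connectP => p; elim: p x => [|z p IHp] x /=; first by move=> _ ->.
by case/andP => /edge_ninv/ltnW xz /IHp zy /zy; apply: leq_trans.
Qed.

Lemma le_edge x y : edge x y -> le x y.
Proof. exact: connect1. Qed.

Lemma le_trans x y z : le x y -> le y z -> le x z.
Proof. exact: connect_trans. Qed.

Lemma le_ninv_eq x y : le x y -> ninv y <= ninv x -> x = y.
Proof.
case/connectP => -[|z p] /= => [_ -> //|/andP[xz zp] yE].
have := edge_ninv xz; have : le z y by apply/connectP; exists p.
by move/le_ninv; lia.
Qed.

Lemma le_first x y : le x y -> x != y -> exists2 z, edge x z & le z y.
Proof.
case/connectP => -[|z p] /= => [_ ->|/andP[xz zp] yE _]; first by rewrite eqxx.
by exists z => //; apply/connectP; exists p.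
Qed.

Lemma le_last x y : le x y -> x != y -> exists2 z, le x z & edge z y.
Proof.
case/connectP => p; elim/last_ind: p => [|p z _] /= => [_ ->|]; first by rewrite eqxx.
rewrite rcons_path last_rcons => /andP[xp pz] -> _.
by exists (last x p) => //; apply/connectP; exists p.
Qed.

(** If the edge is not a cover, some [c] lies between [a] and [b] both in position and in value. The
    edge then refines to three edges beginning with [(a c)], and induction on the length of the
    endpoint applies to the first of them. *)
Lemma edge_refine x y : edge x y ->
  exists2 z, edge x z /\ ninv z = (ninv x).+1 & le z y.
Proof.
move: {2}(ninv y) (leqnn (ninv y)) => k; elim: k y => [|k IHk] y.
  by rewrite leqn0 => /eqP y0 /edge_ninv; rewrite y0.
move=> yk xy; have /edgeP[a [b [ab xab yE]]] := xy.
have [/existsP[c /andP[acb xacb]]|nc] :=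
  boolP [exists c : 'I_n, (a < c < b) && (x a < x c < x b)].
  have ac : a < c by lia. have cb : c < b by lia.
  have xac : x a < x c by lia. have xcb : x c < x b by lia.
  (* Along [x], [z], [z'], [y] the values at [a], [c], [b] form the patterns 123, 213, 312, 321. *)
  pose z := (tperm a c * x)%g.
  have na : a != b by rewrite -(inj_eq val_inj) /=; lia.
  have nc : c != b by rewrite -(inj_eq val_inj) /=; lia.
  have nac : a != c by rewrite -(inj_eq val_inj) /=; lia.
  have xz : edge x z by rewrite edge_tperm.
  pose z' := (tperm a b * z)%g.
  have zz' : edge z z'.
    by rewrite edge_tperm // !permM tpermL tpermD //; lia.
  have z'y : edge z' y.
    have -> : y = (tperm c b * z')%g.
      have E : tperm c a = (tperm c b ^ tperm a b)%g by rewrite tpermJ tpermR tpermD 1?[b == c]eq_sym.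
      by rewrite yE /z' /z [tperm a c]tpermC E conjgE tpermV -!mulgA !tpermKg.
    rewrite edge_tperm // !permM tpermR [tperm a b c]tpermD ?tpermL ?tpermR //.
    by rewrite eq_sym.
  have zy : le z y by apply: le_trans (le_edge zz') (le_edge z'y).
  have [] := IHk z _ xz; first by have := edge_ninv zz'; have := edge_ninv z'y; lia.
  by move=> u xu uz; exists u => //; apply: le_trans uz zy.
exists y; last exact: connect0.
split=> //; rewrite yE ninv_tperm_cover // => c acb; apply: contra nc => xacb.
by apply/existsP; exists c; rewrite acb.
Qed.

Lemma le_cover x y : le x y -> x != y ->
  exists2 z, edge x z /\ ninv z = (ninv x).+1 & le z y.
Proof.
move=> xy /(le_first xy)[z /edge_refine[u xu uz] zy].
by exists u => //; apply: le_trans zy.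
Qed.

End Edges.

(** * Edge labels, their order, and sums over increasing paths *)

Section Labels.

Variable n : nat.
Implicit Types (w x y z t : 'S_n) (a b c i j : 'I_n).

Local Notation edge := (bruhat_edge (Sigma n)).
Local Notation le := (bruhat_le (Sigma n)).

(* The two points moved by a transposition; other permutations do not matter. *)
Definition hi t : nat := \max_(i | t i != i) i.
Definition lo t : nat := \sum_(i | t i != i) i - hi t.

Definition tlt t t' := (hi t < hi t') || ((hi t == hi t') && (lo t < lo t')).

Lemma ord_neq_lt a b : a < b -> a != b.
Proof. by move=> ab; rewrite -(inj_eq val_inj) /=; lia. Qed.

Lemma tperm_moved a b i : a != b -> (tperm a b i != i) = (i == a) || (i == b).
Proof.
move=> ab; case: tpermP => [->|->|/eqP/negPf-> /eqP/negPf->]; rewrite ?eqxx ?orbT //.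
by rewrite eq_sym.
Qed.

Lemma hi_tperm a b : a < b -> hi (tperm a b) = b.
Proof.
move=> ab; have abn := ord_neq_lt ab.
rewrite /hi (eq_bigl _ _ (fun i => tperm_moved i abn)) (bigD1 a) ?eqxx //=.
rewrite (big_pred1 b) => [|i]; first lia.
by case: (eqVneq i a) => [->|]; rewrite ?andbF ?andbT //= (negPf abn).
Qed.

Lemma lo_tperm a b : a < b -> lo (tperm a b) = a.
Proof.
move=> ab; have abn := ord_neq_lt ab.
rewrite /lo (hi_tperm ab) (eq_bigl _ _ (fun i => tperm_moved i abn)) (bigD1 a) ?eqxx //=.
rewrite (big_pred1 b) => [|i]; first lia.
by case: (eqVneq i a) => [->|]; rewrite ?andbF ?andbT //= (negPf abn).
Qed.

Lemma tlt_trans : transitive tlt.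
Proof. by move=> t x y; rewrite /tlt; lia. Qed.

Lemma tlt_irr : irreflexive tlt.
Proof. by move=> t; rewrite /tlt; lia. Qed.

Definition label x y := (y * x^-1)%g.

Lemma label_mul t x : label x (t * x)%g = t.
Proof. exact: mulgK. Qed.

Lemma label_hi x y : edge x y -> 0 < hi (label x y) < n.
Proof.
case/edgeP => a [b [ab _ ->]]; rewrite label_mul hi_tperm // ltn_ord; lia.
Qed.

(* With labels (i c) and (i' c), x has the pattern 213 at the positions i, i', c if
   i < i', and then y' = (i' c) x; if i' < i the pattern at i', i, c is 123, and the
   only other path from x to z starts with the label (i' i). *)
Lemma lo_lt_diamond x y z : edge x y -> edge y z ->
  hi (label x y) = hi (label y z) ->
  (lo (label x y) < lo (label y z)) <->
  exists y', [/\ y' != y, edge x y', hi (label x y') = hi (label x y) & edge y' z].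
Proof.
case/edgeP => i [c [ic xic ->]] /edgeP[i' [c' [ic' yic ->]]].
rewrite !label_mul !hi_tperm // !lo_tperm // => /val_inj cc'; subst c'.
move: yic; rewrite !permM tpermR.
have := tpermP i c i'; case=> [->|E|/eqP i'i /eqP i'c]; first by lia.
  by move: ic'; rewrite E ltnn.
move=> xi'i; have i'nc := ord_neq_lt ic'; have inc := ord_neq_lt ic.
have cni : c != i by rewrite eq_sym.
have ii'n : i != i' by rewrite eq_sym.
split=> [ii'|[y' [y'y /edgeP[j [c' [jc xjc E]]] + /edgeP[a [b [ab yab zE]]]]]].
  exists (tperm i' c * x)%g; split.
  - apply: contra i'i => /eqP/mulIg/(congr1 (fun t : 'S_n => t c)).
    by rewrite !tpermR => ->.
  - by rewrite edge_tperm //; apply: ltn_trans xi'i xic.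
  - by rewrite label_mul hi_tperm.
  - have -> : (tperm i' c * (tperm i c * x) = tperm i i' * (tperm i' c * x))%g.
      have <- : (tperm i i' ^ tperm i' c)%g = tperm i c.
        by rewrite tpermJ tpermL tpermD.
      by rewrite conjgE tpermV -!mulgA !tpermKg.
    by rewrite edge_tperm // !permM tpermL tpermD.
rewrite E label_mul hi_tperm // => /val_inj cc'; subst c' y'.
have {zE} tE : (tperm i' c * tperm i c = tperm a b * tperm j c)%g.
  by apply: (mulIg x); rewrite -!mulgA.
have ev k : tperm i c (tperm i' c k) = tperm j c (tperm a b k).
  by rewrite -!permM tE.
have ji : j != i by apply: contra y'y => /eqP ->.
have jnc := ord_neq_lt jc.
(* If [j] differs from [i'], evaluation at [j] forces [(a b) = (j c)]; then the right side of [tE]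
   is the identity, while the left side sends [i'] to [i]. *)
have ji' : j = i'.
  apply/eqP; apply: contraT => ji'.
  have := ev j; rewrite [tperm i' c j]tpermD ?[tperm i c j]tpermD 1?eq_sym // => /(congr1 (tperm j c)).
  rewrite tpermK tpermL => abj.
  have abjc : tperm a b = tperm j c.
    move: abj; case: tpermP => [-> ->|-> ->|_ _ cj] //; first by rewrite tpermC.
    by rewrite cj eqxx in jnc.
  have := ev i'; rewrite abjc tpermK tpermL tpermR => ii'.
  by rewrite ii' eqxx in i'i.
(* Evaluation at [i] now gives [(a b) = (i i')], and [i' < i] would contradict the direction of the
   edge labelled [(a b)]. *)
subst j; have := ev i; rewrite [tperm i' c i]tpermD // tpermL.
move=> /(congr1 (tperm i' c)); rewrite tpermR tpermK.
case: tpermP => [ia i'b|ib i'a|_ _ i'i2]; first by rewrite ia i'b.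
  move: yab; rewrite -ib -i'a !permM tpermL tpermD // => xci.
  by have := ltn_trans xci xic; rewrite ltnn.
by rewrite i'i2 eqxx in i'i.
Qed.

Definition block c : seq 'S_n := [seq tperm a c | a <- enum 'I_n & a < c].

(** The reflections outside [<<simples k>>], increasing for [tlt]: a final segment of that order,
    and all reflections for [k = 0]. *)
Definition tlist k : seq 'S_n := flatten [seq block c | c <- drop k (enum 'I_n)].

Lemma mem_drop_enum k i : (i \in drop k (enum 'I_n)) = (k <= i).
Proof.
apply/idP/idP => [/(nthP i)[j]|ki].
  rewrite size_drop size_enum_ord nth_drop => jk <-.
  by rewrite nth_enum_ord; lia.
apply/(nthP i); exists (i - k); rewrite ?size_drop ?size_enum_ord ?nth_drop.
  by have := ltn_ord i; lia.
by apply/val_inj; rewrite /= nth_enum_ord subnKC.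
Qed.

Lemma mem_tlist k t :
  reflect (exists a b, [/\ a < b, k <= b & t = tperm a b]) (t \in tlist k).
Proof.
apply: (iffP flatten_mapP) => [[b kb /mapP[a]]|[a [b [ab kb ->]]]].
  rewrite mem_filter => /andP[ab _] ->; exists a, b; split=> //.
  by rewrite -mem_drop_enum.
exists b; first by rewrite mem_drop_enum.
by apply: map_f; rewrite mem_filter ab mem_enum.
Qed.

Lemma mem_tlist_label k x y : edge x y ->
  (label x y \in tlist k) = (k <= hi (label x y)).
Proof.
case/edgeP => a [b [ab xab ->]]; rewrite label_mul hi_tperm //.
apply/mem_tlist/idP => [[a' [b' [ab' kb E]]]|kb]; last by exists a, b.
by rewrite -(hi_tperm ab) E hi_tperm.
Qed.

Lemma pairwise_enum_ord : pairwise (fun i j : 'I_n => i < j) (enum 'I_n).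
Proof.
have := iota_ltn_sorted 0 n.
by rewrite sorted_pairwise; [rewrite -val_enum_ord pairwise_map|apply: ltn_trans].
Qed.

Lemma tlist_pairwise k : pairwise tlt (tlist k).
Proof.
have : pairwise (fun i j : 'I_n => i < j) (drop k (enum 'I_n)).
  by apply: subseq_pairwise (drop_subseq _ _) pairwise_enum_ord.
rewrite /tlist; elim: (drop _ _) => //= c s IHs /andP[/allP cs /IHs sp].
rewrite pairwise_cat sp andbT; apply/andP; split.
  apply/allrelP => t t' /mapP[a]; rewrite mem_filter => /andP[ac _] ->.
  case/flatten_mapP => b bs /mapP[a']; rewrite mem_filter => /andP[ab _] ->.
  by rewrite /tlt !hi_tperm ?cs.
rewrite /block pairwise_map; apply/(pairwiseP c) => i j.
rewrite !inE => ilt jlt ij /=.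
have sp' : pairwise (fun i j : 'I_n => i < j) [seq a : 'I_n <- enum 'I_n | a < c].
  by apply: subseq_pairwise (filter_subseq _ _) pairwise_enum_ord.
have lc k' : k' < size [seq a : 'I_n <- enum 'I_n | a < c] ->
  nth c [seq a : 'I_n <- enum 'I_n | a < c] k' < c.
  by move/(mem_nth c); rewrite mem_filter => /andP[].
rewrite /tlt !hi_tperm ?lc // eqxx !lo_tperm ?lc //.
by apply/orP; right; have /(pairwiseP c) := sp'; apply.
Qed.

Lemma tlist_uniq k : uniq (tlist k).
Proof. exact: pairwise_uniq tlt_irr (tlist_pairwise k). Qed.

Section RtDef.

Local Open Scope ring_scope.

Variables (R : nzRingType) (q : R).

(* The sum of q^(length) over the paths from x to w in the Bruhat graph whose labels
   form a subsequence of L. *)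
Fixpoint Rt (L : seq 'S_n) x w : R :=
  if L is t :: L' then
    Rt L' x w + (if (ninv x < ninv (t * x)%g)%N then q * Rt L' (t * x)%g w else 0)
  else (x == w)%:R.

(** Sorts the paths by their first label [t]. As [L] is increasing, the labels allowed afterwards
    are those above [t], so the tail of the list becomes a filter that refers to the order alone. *)
Lemma Rt_expand L x w : pairwise tlt L ->
  Rt L x w = (x == w)%:R + \sum_(t <- L)
    if (ninv x < ninv (t * x)%g)%N then q * Rt (filter (tlt t) L) (t * x)%g w else 0.
Proof.
elim: L => [_|t L IHL] /=; first by rewrite big_nil addr0.
case/andP => tL /IHL->; rewrite big_cons tlt_irr -addrA; congr (_ + _).
rewrite addrC; congr (_ + _); first by rewrite (all_filterP tL).
apply: eq_big_seq => t' /(allP tL) tt'; case: ifP => // tt; congr (q * Rt _ _ _).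
by move: tt'; rewrite /tlt; case: ifP => //; lia.
Qed.

End RtDef.

End Labels.

(** * Path sums confined to a Bruhat interval *)

Section Intervals.

Variable n : nat.
Implicit Types (w x y z s o t : 'S_n).

Local Notation edge := (bruhat_edge (Sigma n)).
Local Notation le := (bruhat_le (Sigma n)).

Local Notation itv s o := {z : 'S_n | le s z && le z o}.

Lemma itv_lower s o (x : itv s o) : le s (val x).
Proof. by case/andP: (valP x). Qed.

Lemma itv_upper s o (x : itv s o) : le (val x) o.
Proof. by case/andP: (valP x). Qed.

Section Expansion.

Local Open Scope ring_scope.

Variables (R : nzRingType) (q : R).

Lemma Rt_eq0 L x w : {subset L <= reflections (Sigma n)} -> ~~ le x w ->
  Rt q L x w = 0.
Proof.
elim: L x => [|t L IHL] x sub xw /=.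
  by case: eqP xw => // ->; rewrite /bruhat_le connect0.
have subL : {subset L <= reflections (Sigma n)}.
  by move=> t' t'L; apply: sub; rewrite inE t'L orbT.
rewrite IHL // add0r; case: ifP => // xtx; rewrite IHL ?mulr0 //.
apply: contra xw; apply/le_trans/le_edge.
by rewrite /bruhat_edge /= !len_Sigma mulgK sub ?inE ?eqxx.
Qed.

Lemma tlist_reflections k : {subset tlist n k <= reflections (Sigma n)}.
Proof.
by move=> t /mem_tlist[a [b [ab _ ->]]]; apply/reflectionsP; exists a, b.
Qed.

(** The recursion in a form that an isomorphism of intervals can transport, summed over endpoints of
    edges. [P] stands for lying above the last label used; being upward closed, it is absorbed by
    the filter of the next step. *)
Lemma Rt_itv s o k (P : pred 'S_n) (x : itv s o) w :
  (forall t t', P t -> tlt t t' -> P t') -> le w o ->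
  Rt q [seq t <- tlist n k | P t] (val x) w = (val x == w)%:R +
    \sum_(y : itv s o | [&& edge (val x) (val y), (k <= hi (label (val x) (val y)))%N
                         & P (label (val x) (val y))])
      q * Rt q [seq t <- tlist n k | tlt (label (val x) (val y)) t] (val y) w.
Proof.
move=> Pup wo; rewrite Rt_expand ?pairwise_filter ?tlist_pairwise //.
congr (_ + _); rewrite big_uniq ?filter_uniq ?tlist_uniq //= -big_mkcondr.
rewrite (reindex (fun y => label (val x) y)) /=; last first.
  by exists (fun t => t * val x)%g => t _; rewrite /label ?mulgKV ?mulgK.
rewrite (eq_bigl (fun y => [&& edge (val x) y, (k <= hi (label (val x) y))%N
  & P (label (val x) y)])); last first.
  move=> y; rewrite mem_filter /label mulgKV -/(label _ _).
  case: (boolP (edge (val x) y)) => [xy|].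
    by rewrite (edge_ninv xy) mem_tlist_label // andbT andbC.
  rewrite /bruhat_edge /= !len_Sigma negb_and => nxy; apply/negP => /andP[/andP[_ yL]].
  by apply/negP; case/orP: nxy => // /negP; case; apply: tlist_reflections yL.
rewrite (eq_bigr (fun y => q * Rt q [seq t <- tlist n k | tlt (label (val x) y) t] y w));
  last first.
  move=> y /and3P[_ _ Py]; rewrite /label mulgKV -/(label _ _) -filter_predI.
  congr (q * Rt q _ _ _); apply: eq_filter => t /=.
  by case: (boolP (tlt _ t)) => //= /(Pup _ _ Py).
rewrite (bigID (fun y => le y o)) /= [X in _ + X]big1 ?addr0 => [|y]; last first.
  case/andP=> _ yo; rewrite Rt_eq0 ?mulr0 //.
    by move=> t; rewrite mem_filter => /andP[_]; apply: tlist_reflections.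
  by apply: contra yo => /le_trans; apply.
rewrite (reindex_omap (val : itv s o -> 'S_n) insub); last first.
  move=> y /andP[/and3P[xy _ _] yo]; rewrite insubT //= yo andbT.
  exact: le_trans (itv_lower x) (le_edge xy).
by apply: eq_bigl => y; rewrite itv_upper andbT valK eqxx andbT.
Qed.

End Expansion.

End Intervals.

(** * Isomorphisms preserve ends and length differences *)

Section IsoRank.

Variables (n1 n2 : nat) (s1 o1 : 'S_n1) (s2 o2 : 'S_n2).

Local Notation I1 := (bruhat_interval (Sigma n1) s1 o1).
Local Notation I2 := (bruhat_interval (Sigma n2) s2 o2).
Local Notation E1 := (@bruhat_interval_edge _ (Sigma n1) s1 o1).
Local Notation E2 := (@bruhat_interval_edge _ (Sigma n2) s2 o2).

Variable phi : I1 -> I2.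
Hypothesis phi_iso : digraph_iso E1 E2 phi.

Lemma phi_max x : val x = o1 -> val (phi x) = o2.
Proof.
case: phi_iso => [[psi _ phiK] phiE] xo; apply/eqP; apply: contraT => nphi.
have [z xz zo] := le_first (itv_upper (phi x)) nphi.
have zI : bruhat_le (Sigma n2) s2 z && bruhat_le (Sigma n2) z o2.
  by rewrite zo andbT; apply: le_trans (itv_lower (phi x)) (le_edge xz).
have : E1 x (psi (exist _ z zI)) by rewrite phiE phiK.
move/edge_ninv => /= xpsi; have := leq_trans xpsi (le_ninv (itv_upper (psi (exist _ z zI)))).
by rewrite -(congr1 (@ninv n1) xo) ltnn.
Qed.

Lemma phi_min x : val x = s1 -> val (phi x) = s2.
Proof.
case: phi_iso => [[psi _ phiK] phiE] xs; apply/eqP; apply: contraT; rewrite eq_sym => nphi.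
have [z sz zx] := le_last (itv_lower (phi x)) nphi.
have zI : bruhat_le (Sigma n2) s2 z && bruhat_le (Sigma n2) z o2.
  by rewrite sz; apply: le_trans (le_edge zx) (itv_upper (phi x)).
have : E1 (psi (exist _ z zI)) x by rewrite phiE phiK.
move/edge_ninv/(leq_ltn_trans (le_ninv (itv_lower (psi (exist _ z zI))))).
by rewrite (congr1 (@ninv n1) xs) ltnn.
Qed.

(** A chain of covers from [x] to [o1] maps to a chain of equally many edges, each raising [ninv] by
    at least one. *)
Lemma phi_corank_le x :
  ninv o1 - ninv (val x) <= ninv o2 - ninv (val (phi x)).
Proof.
case: phi_iso => _ phiE.
have [m] := ubnP (ninv o1 - ninv (val x)); elim: m x => // m IHm x xm.
have [xo|nxo] := eqVneq (val x) o1; first by rewrite xo subnn.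
have [z [xz zx1] zo] := le_cover (itv_upper x) nxo.
have zI : bruhat_le (Sigma n1) s1 z && bruhat_le (Sigma n1) z o1.
  by rewrite zo andbT; apply: le_trans (itv_lower x) (le_edge xz).
pose z' : I1 := exist _ z zI.
have xz' : E1 x z' by [].
rewrite phiE in xz'; have h1 := edge_ninv xz'.
have h2 : ninv (val (phi z')) <= ninv o2 := le_ninv (itv_upper (phi z')).
have h3 : ninv z <= ninv o1 := le_ninv zo.
have aux a a1 b c c1 d k : a1 = a.+1 -> b - a < k.+1 -> c < c1 -> c1 <= d -> a1 <= b ->
  (b - a1 < k -> b - a1 <= d - c1) -> b - a <= d - c by lia.
exact: aux zx1 xm h1 h2 h3 (IHm z').
Qed.

End IsoRank.

Lemma phi_corank n1 n2 (s1 o1 : 'S_n1) (s2 o2 : 'S_n2)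
    (phi : bruhat_interval (Sigma n1) s1 o1 -> bruhat_interval (Sigma n2) s2 o2) x :
  digraph_iso (@bruhat_interval_edge _ _ _ _) (@bruhat_interval_edge _ _ _ _) phi ->
  ninv o1 - ninv (val x) = ninv o2 - ninv (val (phi x)).
Proof.
move=> phi_iso; have [[psi phiK psiK] phiE] := phi_iso.
apply/eqP; rewrite eqn_leq phi_corank_le //=.
rewrite -[X in _ <= _ - ninv (val X)]phiK; apply: phi_corank_le; split.
  by exists phi.
by move=> z z'; rewrite phiE !psiK.
Qed.

(** * Invariance of path sums under coloured isomorphisms *)

Section Invariance.

Variables (n1 n2 : nat) (s1 o1 : 'S_n1) (s2 o2 : 'S_n2).

Local Notation I1 := (bruhat_interval (Sigma n1) s1 o1).
Local Notation I2 := (bruhat_interval (Sigma n2) s2 o2).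
Local Notation E1 := (@bruhat_interval_edge _ (Sigma n1) s1 o1).
Local Notation E2 := (@bruhat_interval_edge _ (Sigma n2) s2 o2).
Local Notation lab := (edge_reflection).

Variable phi : I1 -> I2.
Hypothesis phi_iso : digraph_iso E1 E2 phi.

Lemma phi_bij : bijective phi. Proof. by case: phi_iso. Qed.
Lemma phi_edge x y : E1 x y = E2 (phi x) (phi y). Proof. by case: phi_iso. Qed.

(** Only labels with [hi] at or above the threshold enter the path sums. The relative R-polynomials
    use [n.-1], where a single colour remains, and the full ones use 0. *)
Variables k1 k2 : nat.
Hypothesis phi_hi : forall x y, E1 x y ->
  (k1 <= hi (lab x y)) = (k2 <= hi (lab (phi x) (phi y))).
Hypothesis phi_hi_lt : forall x y x' y', E1 x y -> E1 x' y' ->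
  k1 <= hi (lab x y) -> k1 <= hi (lab x' y') ->
  (hi (lab x y) < hi (lab x' y')) =
  (hi (lab (phi x) (phi y)) < hi (lab (phi x') (phi y'))).

Lemma phi_hi_eq x y x' y' : E1 x y -> E1 x' y' ->
  k1 <= hi (lab x y) ->
  (hi (lab x y) == hi (lab x' y')) =
  (hi (lab (phi x) (phi y)) == hi (lab (phi x') (phi y'))).
Proof.
move=> xy xy' kxy; case: (boolP (k1 <= hi (lab x' y'))) => kxy'.
  have := phi_hi_lt xy xy' kxy kxy'; have := phi_hi_lt xy' xy kxy' kxy.
  by case: (ltngtP (hi (lab x y))) => _; case: ltngtP.
have kE := phi_hi xy'; have kE' := phi_hi xy.
by apply/eqP/eqP; lia.
Qed.

Lemma edge_le n (s o : 'S_n) (x y : bruhat_interval (Sigma n) s o) z :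
  bruhat_edge (Sigma n) (val x) z -> bruhat_edge (Sigma n) z (val y) ->
  bruhat_le (Sigma n) s z && bruhat_le (Sigma n) z o.
Proof.
move=> xz zy; rewrite (le_trans (itv_lower x) (le_edge xz)).
exact: le_trans (le_edge zy) (itv_upper y).
Qed.

(** The [y'] of the diamond criterion lies between [x] and [z], so the criterion can be read inside
    the interval. *)
Lemma lo_lt_itv n (s o : 'S_n) (x y z : bruhat_interval (Sigma n) s o) :
  bruhat_interval_edge x y -> bruhat_interval_edge y z ->
  hi (lab x y) = hi (lab y z) ->
  (lo (lab x y) < lo (lab y z)) <->
  exists y', [/\ y' <> y, bruhat_interval_edge x y',
     hi (lab x y') = hi (lab x y) & bruhat_interval_edge y' z].
Proof.
move=> xy yz hE; apply: (iff_trans (lo_lt_diamond xy yz hE)); split.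
  case=> y' [ny xy' hy' y'z]; exists (exist _ y' (edge_le xy' y'z)); split=> //.
  by move/(congr1 val); apply/eqP.
case=> y' [ny xy' hy' y'z]; exists (val y'); split => //.
by apply/eqP => /val_inj.
Qed.

(** For equal colours the comparison is the diamond criterion, which mentions only edges and colours
    and so passes through [phi] in both directions. *)
Lemma phi_tlt x y z : E1 x y -> E1 y z ->
  k1 <= hi (lab x y) -> k1 <= hi (lab y z) ->
  tlt (lab x y) (lab y z) = tlt (lab (phi x) (phi y)) (lab (phi y) (phi z)).
Proof.
move=> xy yz kxy kyz; rewrite /tlt phi_hi_lt // phi_hi_eq //; congr (_ || _).
apply: andb_id2l => /eqP hE'.
have hE : hi (lab x y) = hi (lab y z) by apply/eqP; rewrite phi_hi_eq // hE'.
have xy' : E2 (phi x) (phi y) by rewrite -phi_edge.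
have yz' : E2 (phi y) (phi z) by rewrite -phi_edge.
apply/idP/idP.
  case/(lo_lt_itv xy yz hE) => u [uy xu hu uz].
  apply/(lo_lt_itv xy' yz' hE'); exists (phi u); split; rewrite -?phi_edge //.
    by move/(bij_inj phi_bij).
  by apply/eqP; rewrite -phi_hi_eq ?hu.
case/(lo_lt_itv xy' yz' hE') => u' [uy xu hu uz].
have [psi _ phiK] := phi_bij; rewrite -(phiK u') in uy xu hu uz.
rewrite -!phi_edge in xu uz.
apply/(lo_lt_itv xy yz hE); exists (psi u'); split => //; first by move=> uE; rewrite uE in uy.
apply/eqP; rewrite eq_sym phi_hi_eq //; exact/eqP.
Qed.

Lemma phi_Rt (R : nzRingType) (q : R) x w :
  Rt q (tlist n1 k1) (val x) (val w) = Rt q (tlist n2 k2) (val (phi x)) (val (phi w)).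
Proof.
(* The induction needs a condition on the next label: none at first, then lying above the label just
   used. The two conditions need to match only on edges leaving [x]. *)
suff H (P1 : pred 'S_n1) (P2 : pred 'S_n2) :
  (forall t t', P1 t -> tlt t t' -> P1 t') ->
  (forall t t', P2 t -> tlt t t' -> P2 t') ->
  (forall y, E1 x y -> k1 <= hi (lab x y) -> P1 (lab x y) = P2 (lab (phi x) (phi y))) ->
  Rt q [seq t <- tlist n1 k1 | P1 t] (val x) (val w) =
  Rt q [seq t <- tlist n2 k2 | P2 t] (val (phi x)) (val (phi w)).
  by have := H xpredT xpredT; rewrite !filter_predT; apply.
have [m] := ubnP (ninv o1 - ninv (val x)).
elim: m x P1 P2 => // m IHm x P1 P2 mx up1 up2 P12.
rewrite !Rt_itv ?itv_upper //; congr (_ + _)%R.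
  suff -> : (val x == val w) = (val (phi x) == val (phi w)) by [].
  by apply/eqP/eqP => [/val_inj-> //|/val_inj/(bij_inj phi_bij)->].
rewrite [in RHS](reindex phi) /=; last exact/onW_bij/phi_bij.
apply: eq_big => [y|y /and3P[xy kxy Py]].
  have -> : bruhat_edge (Sigma n2) (val (phi x)) (val (phi y)) =
    bruhat_edge (Sigma n1) (val x) (val y) by rewrite [RHS]phi_edge.
  by apply: andb_id2l => xy; rewrite [k1 <= _]phi_hi //; apply: andb_id2l => kxy;
    rewrite [P1 _]P12 // [k1 <= _]phi_hi.
congr (q * _)%R; apply: IHm.
- have xy' : ninv (val x) < ninv (val y) := edge_ninv xy.
  have yo : ninv (val y) <= ninv o1 := le_ninv (itv_upper y).
  have aux a b c k : a < b -> b <= c -> c - a < k.+1 -> c - b < k by lia.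
  exact: aux xy' yo mx.
- by move=> t t' ; apply: tlt_trans.
- by move=> t t' ; apply: tlt_trans.
- by move=> z yz kyz; apply: phi_tlt.
Qed.

End Invariance.

(** * Multiplication in the Hecke algebra *)

Section Hecke.

Local Open Scope ring_scope.

Variables (n : nat) (H : heckeAlgebra (Sigma n)).
Implicit Types (w x y z s o t u : 'S_n) (a b : 'I_n).

Local Notation h := (@hecke_h _ _ H).
Local Notation q := (v^-1 - v).

Lemma h_mul x y : (ninv x + ninv y)%N = ninv (x * y)%g -> h x * h y = h (x * y)%g.
Proof. by move=> xy; apply: hecke_mul; rewrite !len_Sigma. Qed.

Lemma h_free (c d : 'S_n -> laurent) :
  \sum_w c w *: h w = \sum_w d w *: h w -> c =1 d.
Proof.
move=> cd; have [e [_ eU]] := hecke_basis (\sum_w c w *: h w).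
have ec : e = [ffun w => c w] by apply: eU; apply: eq_bigr => w _; rewrite ffunE.
have ed : e = [ffun w => d w].
  by apply: eU; rewrite cd; apply: eq_bigr => w _; rewrite ffunE.
by move=> w; have := congr1 (fun f : {ffun 'S_n -> laurent} => f w) (etrans (esym ec) ed);
  rewrite !ffunE.
Qed.

Lemma ninv1 : ninv (1 : 'S_n)%g = 0%N.
Proof.
apply/eqP; rewrite cards_eq0; apply/eqP/setP => p; rewrite !inE !perm1; lia.
Qed.

(** Left multiplication by [h 1] fixes every basis element, hence also the unit expanded in the
    basis. *)
Lemma h_one : h 1%g = 1.
Proof.
have [c [E _]] := hecke_basis (1 : H).
rewrite -[LHS]mulr1 E mulr_sumr; apply: eq_bigr => w _.
by rewrite -scalerAr h_mul ?mul1g // ninv1.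
Qed.

Lemma h_quad a b : a.+1 = b -> h (tperm a b) * h (tperm a b) = 1 + q *: h (tperm a b).
Proof.
move=> ab; have sS : tperm a b \in Sigma n.
  by rewrite -simples_full; apply/simplesP; exists a, b.
have := hecke_quadratic H sS; rewrite mulrDl !mulrBr.
rewrite -!scalerAl -!scalerAr !mul1r !mulr1 scalerA mulrV ?v_unit // scale1r.
move/eqP; rewrite addrA subr_eq0 => /eqP E.
by rewrite scalerBl -[in RHS]E addrA [X in _ = X - _]addrAC subrK addrK.
Qed.

Lemma h_simple_up a b x : a.+1 = b -> (x a < x b)%N ->
  h (tperm a b) * h x = h (tperm a b * x)%g.
Proof.
move=> ab xab; apply: h_mul; rewrite (ninv_adjacent ab xab).
by rewrite -[X in ninv X]mulg1 (ninv_adjacent ab) ?ninv1 ?perm1 // -ab.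
Qed.

Lemma h_simple a b x : a.+1 = b ->
  h (tperm a b) * h x = h (tperm a b * x)%g + (if (x b < x a)%N then q *: h x else 0).
Proof.
move=> ab; have nab : b != a by rewrite -(inj_eq val_inj) /=; lia.
case: (boolP (x b < x a)%N) => xba; last first.
  by rewrite addr0 h_simple_up // (perm_leqNlt x) // eq_sym.
have sx : h x = h (tperm a b) * h (tperm a b * x)%g.
  by rewrite h_simple_up ?tpermKg // !permM tpermL tpermR.
by rewrite {1}sx mulrA h_quad // mulrDl mul1r -scalerAl -sx.
Qed.

Lemma h_unit x : h x \is a GRing.unit.
Proof.
move xk: (ninv x) => k; elim: k x xk => [|k IHk] x xk.
  have [->|x1] := eqVneq x 1%g; first by rewrite h_one unitr1.
  have [a [b [ab _ xba]]] := fixes_above_descent (@fixes_above_full n x) x1.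
  by rewrite (ninv_adjacentN ab xba) in xk.
have [x1|x1] := eqVneq x 1%g; first by rewrite x1 ninv1 in xk.
have [a [b [ab _ xba]]] := fixes_above_descent (@fixes_above_full n x) x1.
have -> : h x = h (tperm a b) * h (tperm a b * x)%g.
  by rewrite h_simple_up ?tpermKg // !permM tpermL tpermR.
(* By the quadratic relation the inverse of h_s is h_s - [q]. *)
have hs_inv : h (tperm a b) * (h (tperm a b) - q%:A) = 1.
  by rewrite mulrBr h_quad // -scalerAr mulr1 addrK.
have hs_inv' : (h (tperm a b) - q%:A) * h (tperm a b) = 1.
  by rewrite mulrBl h_quad // -scalerAl mul1r addrK.
rewrite unitrMl; first by apply/unitrP; exists (h (tperm a b) - q%:A).
by apply: IHk; rewrite (ninv_adjacentN ab xba) in xk; case: xk.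
Qed.

(** Divided by the unit [h u], this says that [Rt q L x w] is the coefficient of [h w] at
    [hecke_f x u]. *)
Definition Rt_expansion u (L : seq 'S_n) := forall w,
  h u * h w = \sum_x Rt q L x w *: h (u * x)%g.

Lemma Rt_expansion_nil : Rt_expansion 1%g [::].
Proof.
move=> w; rewrite h_one mul1r (bigD1 w) //= eqxx scale1r mul1g big1 ?addr0 // => x.
by move=> /negPf xw; rewrite xw scale0r.
Qed.

(** With [t = (a b)], [u t = s u] for a simple [s] that increases the length, so the expansion for
    [u] is multiplied by [h s] on the left. Its leading terms keep their coefficients; the terms
    with [q], reindexed by [t], are the paths with first label [t]. *)
Lemma Rt_expansion_cons u L a b : (u^-1%g a).+1 = u^-1%g b -> (a < b)%N ->
  Rt_expansion u L -> Rt_expansion (u * tperm a b)%g (tperm a b :: L).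
Proof.
move=> uab ab uL w; set t := tperm a b.
pose i := u^-1%g a; pose j := u^-1%g b; pose s := tperm i j.
have ut : (u * t = s * u)%g.
  have -> : t = (s ^ u)%g by rewrite tpermJ !permKV.
  by rewrite conjgE mulKVg.
have -> : h (u * t)%g = h s * h u.
  by rewrite ut h_simple_up // !permKV.
rewrite -mulrA uL mulr_sumr.
under eq_bigr => x _ do rewrite -scalerAr h_simple // mulgA -ut !permM !permKV scalerDr.
rewrite big_split /=; under [in RHS]eq_bigr => x _ do rewrite scalerDl.
rewrite [in RHS]big_split /=; congr (_ + _).
rewrite (reindex_inj (mulgI t)) /=; apply: eq_bigr => x _.
rewrite -mulgA /t -(@ninv_tpermN n a b (t * x)%g) // tpermKg.
by case: ifP => _; rewrite ?scaler0 ?scale0r // scalerA mulrC.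
Qed.

End Hecke.

(** * Relative R-polynomials as path sums *)

Section TransitionMatrix.

Local Open Scope ring_scope.

Variables (n : nat) (H : heckeAlgebra (Sigma n)).
Implicit Types (w x y z s o t u : 'S_n) (a b : 'I_n).

Local Notation h := (@hecke_h _ _ H).
Local Notation q := (v^-1 - v).

Lemma drop_enum_ord j (jn : (j < n)%N) :
  drop j (enum 'I_n) = Ordinal jn :: drop j.+1 (enum 'I_n).
Proof.
rewrite (drop_nth (Ordinal jn)) ?size_enum_ord //; congr (_ :: _).
by apply/val_inj; rewrite /= nth_enum_ord.
Qed.

Let partial_block (c : 'I_n) j : seq 'S_n :=
  [seq tperm a c | a : 'I_n <- drop j (enum 'I_n) & (a < c)%N].

(* The position reached once the labels (a b), b > c, and (a c), a >= j, are used. *)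
Let state u (c j : nat) := forall x : 'I_n, u^-1%g x =
  (if x < j then n.-1 - c + x else if x < c then n - c + x
   else if x == c :> nat then n.-1 - c + j else n.-1 - x)%N :> nat.

(** The labels [(a c)] are prepended from [a = c - 1] down to 0; [state] makes the inverse of [u]
    send [a] and [c] to adjacent positions each time. *)
Lemma Rt_expansion_block (c : 'I_n) u L : state u c c -> Rt_expansion H u L ->
  exists2 u', state u' c 0 & Rt_expansion H u' (block c ++ L).
Proof.
move=> uc uL.
suff /(_ 0%N (leq0n c)) [u' u'0 u'L] : forall j, (j <= c)%N ->
    exists2 u', state u' c j & Rt_expansion H u' (partial_block c j ++ L).
  by exists u' => //; move: u'L; rewrite /partial_block drop0.
move=> j jc; rewrite -(subKn jc); elim: (c - j)%N (leq_subr j c) => [_|d IHd dc].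
  exists u; rewrite subn0 // /partial_block (_ : [seq _ <- _ | _] = [::]) //.
  apply/eqP; rewrite -[_ == _]negbK -has_filter; apply/hasPn => a.
  by rewrite mem_drop_enum -leqNgt.
have [u' u'd u'L] := IHd (ltnW dc).
set i := (c - d.+1)%N; have iE : (c - d)%N = i.+1 by lia.
rewrite iE in u'd u'L.
have in_ : (i < n)%N by have := ltn_ord c; lia.
have ic : (Ordinal in_ < c)%N by rewrite /=; lia.
exists (u' * tperm (Ordinal in_) c)%g.
  move=> x; rewrite invMg tpermV permM.
  case: tpermP => [->|->|/eqP xi /eqP xc]; rewrite u'd /=.
  - by have := ltn_ord c; do !case: ifP; lia.
  - by have := ltn_ord c; do !case: ifP; lia.
  - rewrite -!(inj_eq val_inj) /= in xi xc.
    by have := ltn_ord x; do !case: ifP; lia.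
rewrite /partial_block drop_enum_ord /= ic /=; apply: Rt_expansion_cons => //.
by rewrite !u'd /=; have := ltn_ord c; do !case: ifP; lia.
Qed.

Lemma Rt_expansion_tlist k : (k <= n)%N ->
  Rt_expansion H (rev_perm n n * rev_perm n k)%g (tlist n k).
Proof.
move=> kn.
(* The inverse of w_0 w_0^J shifts the positions below [k] up by [n - k] and reverses the others. *)
suff [u uk uL] : exists2 u : 'S_n, forall x : 'I_n, u^-1%g x =
    (if x < k then n - k + x else n.-1 - x)%N :> nat & Rt_expansion H u (tlist n k).
  suff -> : (rev_perm n n * rev_perm n k)%g = u by [].
  apply: invg_inj; apply/permP => x; apply/val_inj => /=.
  rewrite uk invMg !rev_permV permM !rev_permE; have := ltn_ord x.
  by do !case: ifP; lia.
rewrite -(subKn kn); elim: (n - k)%N (leq_subr k n) => [_|d IHd dn].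
  exists 1%g; rewrite subn0; first by move=> x; rewrite invg1 perm1 ltn_ord subnn.
  rewrite /tlist drop_oversize ?size_enum_ord //; exact: Rt_expansion_nil.
have [u ud uL] := IHd (ltnW dn).
set i := (n - d.+1)%N; have iE : (n - d)%N = i.+1 by lia.
have in_ : (i < n)%N by lia.
rewrite iE in ud uL; case: (@Rt_expansion_block (Ordinal in_) u (tlist n i.+1)) => //.
  by move=> x; rewrite ud /=; have := ltn_ord x; do !case: ifP; lia.
move=> u' u'E u'L; exists u'; last by rewrite /tlist drop_enum_ord.
by move=> x; rewrite u'E /=; have := ltn_ord x; do !case: ifP; lia.
Qed.

Lemma Rpoly_Rt k s o : (k <= n)%N ->
  Rpoly H (simples n k) s o =
    v ^ ((ninv s)%:Z - (ninv o)%:Z) * Rt q (tlist n k) s o.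
Proof.
move=> kn; rewrite /Rpoly !len_Sigma; congr (_ * _).
have LS : longest (Sigma n) = rev_perm n n by rewrite -simples_full longest_simples.
rewrite LS longest_simples /dual_basis; set tau := (_ * _)%g.
set P := (fun c : {ffun _ -> laurent} => _).
pose c := [ffun x => Rt q (tlist n k) x o].
suff -> : classical_sets.xget 0 P = c by rewrite ffunE.
have PE (d : {ffun 'S_n -> laurent}) :
  P d <-> h tau * h o = \sum_x d x *: h (tau * x)%g.
  have E : h tau * (\sum_x d x *: hecke_f H x tau) = \sum_x d x *: h (tau * x)%g.
    rewrite mulr_sumr; apply: eq_bigr => x _.
    by rewrite -scalerAr /hecke_f mulrA divrr ?h_unit // mul1r.
  by rewrite /P -E; split=> [-> //|/(mulrI (h_unit H tau))].
have Pc : P c.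
  by apply/PE; rewrite (Rt_expansion_tlist kn); apply: eq_bigr => x _; rewrite ffunE.
(* [dual_basis] chooses some coefficient vector; it is unique because left multiplication by [tau]
   permutes the free family [h]. *)
apply: classical_sets.xget_unique => // d /PE; rewrite (PE c).1 // => /esym E.
have shift (e : {ffun 'S_n -> laurent}) :
    \sum_x e x *: h (tau * x)%g = \sum_x e (tau^-1 * x)%g *: h x.
  by rewrite (reindex_inj (mulgI tau^-1%g)); apply: eq_bigr => x _; rewrite mulKVg.
rewrite !shift in E; apply/ffunP => x.
by have := h_free E (tau * x)%g; rewrite mulKg.
Qed.

End TransitionMatrix.

(** * Inversions of inverses and of products with w_0 *)

Section InversionCounts.

Variable n : nat.
Implicit Types x : 'S_n.

Lemma ninvV x : ninv x^-1%g = ninv x.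
Proof.
pose f (p : 'I_n * 'I_n) := (x p.2, x p.1).
have f_inj : injective f by case=> a b [c d] [/perm_inj-> /perm_inj->].
rewrite /ninv -[RHS](card_imset _ f_inj); apply: eq_card => -[i j].
rewrite inE /=; apply/andP/imsetP => [[ij xji]|[[a b]]].
  exists (x^-1%g j, x^-1%g i); last by rewrite /f /= !permKV.
  by rewrite inE /= xji !permKV.
by rewrite inE /f /= => /andP[ab xba] [-> ->]; rewrite !permK.
Qed.

(** Reversal matches the inversions of w_0 [x] with the pairs that [x] does not invert. The form
    with [x^-1] makes lengths add in the product of h at w_0 [x] and at [x^-1]. *)
Lemma ninv_rev_mul x : ninv (rev_perm n n * x)%g + ninv x^-1%g = ninv (rev_perm n n).
Proof.
rewrite ninvV; pose r := rev_perm n n; pose f (p : 'I_n * 'I_n) := (r p.2, r p.1).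
have rE (i : 'I_n) : r i = n.-1 - i :> nat by rewrite rev_permE ltn_ord minnn.
have r_lt (i j : 'I_n) : (r i < r j) = (j < i).
  by rewrite !rE; have := ltn_ord i; have := ltn_ord j; lia.
have rK (i : 'I_n) : r (r i) = i by rewrite !permE rev_funK.
have f_inj : injective f by case=> a b [c d] [/perm_inj-> /perm_inj->].
rewrite /ninv -(cardsID (inversions x) (inversions r)) addnC.
congr (_ + _); first apply: eq_card => -[i j].
  by rewrite !inE /= r_lt; case: (i < j).
rewrite -(card_imset _ f_inj); apply: eq_card => -[i j].
apply/imsetP/idP => [[[a b]]|].
  rewrite !inE /= !permM => /andP[ab xba] [-> ->]; rewrite !r_lt ab /=.
  by rewrite -leqNgt ltnW.
rewrite !inE /= r_lt => /andP[+ /andP[ij _]]; rewrite ij /= => xij.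
exists (r j, r i); rewrite ?inE /f /= ?rK // !permM !rK r_lt ij /=.
by rewrite (perm_leqNlt x) // -(inj_eq val_inj) /=; lia.
Qed.

End InversionCounts.

(** * Recovering a polynomial of bounded degree from its antisymmetrization *)

Section LaurentValues.

Local Open Scope ring_scope.

Fact laurent_poly_is_zmod_morphism : zmod_morphism laurent_poly.
Proof.
move=> a b; apply: laurent_val_inj; rewrite [RHS]laurent_val_add.
by rewrite [laurent_val (- _)]laurent_val_opp !laurent_val_poly tofracB.
Qed.

Fact laurent_poly_is_monoid_morphism : monoid_morphism laurent_poly.
Proof.
split=> [//|a b]; apply: laurent_val_inj.
by rewrite laurent_valM !laurent_val_poly tofracM.
Qed.

HB.instance Definition _ := GRing.isZmodMorphism.Build {poly int} laurent laurent_poly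
  laurent_poly_is_zmod_morphism.
HB.instance Definition _ := GRing.isMonoidMorphism.Build {poly int} laurent laurent_poly
  laurent_poly_is_monoid_morphism.

Lemma laurent_poly_inj : injective laurent_poly.
Proof.
by move=> a b /(congr1 laurent_val); rewrite !laurent_val_poly => /eqP; rewrite tofrac_eq => /eqP.
Qed.

Lemma horner_intr (R : nzRingType) (p : {poly int}) (x : R) :
  (map_poly intr p).[x] = \sum_(i < size p) (p`_i)%:~R * x ^+ i.
Proof. exact: horner_poly. Qed.

(* Only positive powers of v occur in [v ^ k * p (v^-2)] when 2 deg p < k, so
   this element determines its difference with its image under v -> v^-1. *)
Lemma self_dual_eq0 (p : {poly int}) (k : nat) : (2 * (size p).-1 < k)%N ->
  v ^ (- k%:Z) * (map_poly intr p).[v ^+ 2] = v ^ k%:Z * (map_poly intr p).[v ^- 2] ->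
  p = 0.
Proof.
move=> degp /(congr1 ( *%R (v ^ k%:Z))).
rewrite mulrA -exprzDr ?v_unit // subrr expr0z mul1r mulrA -exprzDr ?v_unit //.
rewrite !horner_intr mulr_sumr.
have -> : \sum_(i < size p) v ^ (k%:Z + k%:Z) * ((p`_i)%:~R * (v ^- 2) ^+ i) =
    laurent_poly (\sum_(i < size p) (p`_i)%:~R * 'X ^+ (2 * k - 2 * i)).
  rewrite rmorph_sum; apply: eq_bigr => i _; rewrite rmorphM rmorph_int rmorphXn /=.
  rewrite mulrCA; congr (_ * _).
  rewrite -exprVn -exprM exprVn exprnN -exprzDr ?v_unit //.
  rewrite (_ : k%:Z + k%:Z + - (2 * i)%:Z = (2 * k - 2 * i)%N%:Z) //.
  by have := ltn_ord i; lia.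
have -> : \sum_(i < size p) ((p`_i)%:~R * (v ^+ 2) ^+ i) =
    laurent_poly (\sum_(i < size p) (p`_i)%:~R * 'X ^+ (2 * i)).
  rewrite rmorph_sum; apply: eq_bigr => i _; rewrite rmorphM rmorph_int rmorphXn /=.
  by rewrite exprM.
move/laurent_poly_inj/(congr1 (fun r : {poly int} => r`_(2 * (size p).-1))).
rewrite !coef_sum => E; apply/eqP; apply: contraT => p0.
have sp : (0 < size p)%N by rewrite size_poly_gt0.
have lt : ((size p).-1 < size p)%N by lia.
move: E; rewrite (bigD1 (Ordinal lt)) //= big1 => [|i ni]; last first.
  rewrite mulrzl coefMrz coefXn; case: eqP => [E|]; rewrite ?mul0rz //.
  by case/eqP: ni; apply: val_inj => /=; lia.
rewrite big1 => [|i _]; last first.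
  rewrite mulrzl coefMrz coefXn; case: eqP => [E|]; rewrite ?mul0rz //.
  have aux (m i' : nat) : (2 * m.-1 < k)%N -> (i' < m)%N ->
    (2 * m.-1)%N <> (2 * k - 2 * i')%N by lia.
  by case: (aux _ _ degp (ltn_ord i) E).
rewrite mulrzl coefMrz coefXn eqxx addr0 intz => /eqP.
by rewrite -[_`__]/(lead_coef p) lead_coef_eq0 (negPf p0).
Qed.

Lemma self_dual_inj (p r : {poly int}) (k : nat) :
  (2 * (size p).-1 < k)%N -> (2 * (size r).-1 < k)%N ->
  v ^ (- k%:Z) * (map_poly intr p).[v ^+ 2] - v ^ k%:Z * (map_poly intr p).[v ^- 2] =
  v ^ (- k%:Z) * (map_poly intr r).[v ^+ 2] - v ^ k%:Z * (map_poly intr r).[v ^- 2] ->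
  p = r.
Proof.
move=> degp degr E; apply/eqP; rewrite -subr_eq0; apply/eqP/(@self_dual_eq0 _ k).
  have aux (a b c : nat) : (c <= maxn a b)%N -> (2 * a.-1 < k)%N ->
    (2 * b.-1 < k)%N -> (2 * c.-1 < k)%N by lia.
  by apply: aux (size_polyD _ _) _ _; rewrite ?size_polyN.
rewrite !rmorphB !hornerD !hornerN !mulrBr.
have aux (V : zmodType) (x y z w : V) : x - z = y - w -> x - y = z - w.
  by move/eqP; rewrite subr_eq => /eqP->; rewrite addrC -addrA addKr addrC.
exact: aux.
Qed.

End LaurentValues.

(** * The bar-conjugate basis and the Kazhdan-Lusztig recursion *)

Section BarBasis.

Local Open Scope ring_scope.

Variables (n : nat) (H : heckeAlgebra (Sigma n)).
Implicit Types (x w s o : 'S_n).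

Local Notation h := (@hecke_h _ _ H).
Local Notation q := (v^-1 - v).

(** The image of [h x] under the bar involution, written without reference to it. *)
Definition hbar x : H := (h x^-1%g)^-1.

Local Notation R := (Rt q (tlist n 0)).

Lemma h_rev_hbar x : h (rev_perm n n) * hbar x = h (rev_perm n n * x)%g.
Proof.
rewrite /hbar; set r := rev_perm n n.
have <- : h (r * x)%g * h x^-1%g = h r by rewrite h_mul ?ninv_rev_mul ?mulgK.
by rewrite mulrK ?h_unit.
Qed.

(** For [u] = w_0 the path sums expand the product of h at w_0 with [h o]; cancelling the unit at
    w_0 by [h_rev_hbar] leaves the basis [hbar]. *)
Lemma h_hbar o : h o = \sum_x R x o *: hbar x.
Proof.
apply: (mulrI (h_unit H (rev_perm n n))); rewrite mulr_sumr.
have := Rt_expansion_tlist H (leq0n n) o.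
have -> : rev_perm n 0 = 1%g by apply/permP => i; apply/val_inj; rewrite /= rev_permE perm1.
rewrite mulg1 => ->; apply: eq_bigr => x _.
by rewrite -scalerAr h_rev_hbar.
Qed.

Lemma hbar_free (c d : 'S_n -> laurent) :
  \sum_x c x *: hbar x = \sum_x d x *: hbar x -> c =1 d.
Proof.
have rK x : (rev_perm n n * (rev_perm n n * x) = x)%g.
  by rewrite -{1}[rev_perm n n]rev_permV mulKg.
move/(congr1 ( *%R (h (rev_perm n n)))); rewrite !mulr_sumr => E.
have shift (e : 'S_n -> laurent) : \sum_x h (rev_perm n n) * (e x *: hbar x) =
    \sum_x e (rev_perm n n * x)%g *: h x.
  rewrite [RHS](reindex_inj (mulgI (rev_perm n n)%g)); apply: eq_bigr => x _.
  by rewrite -scalerAr h_rev_hbar rK.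
move=> x; rewrite !shift in E; have := h_free E (rev_perm n n * x)%g.
by rewrite /= rK.
Qed.

(* The coefficient of h_s in KL_element P o, and its image under v -> v^-1. *)
Definition pos_part (P : 'S_n -> 'S_n -> {poly int}) s o : laurent :=
  v ^ ((ninv o)%:Z - (ninv s)%:Z) * (map_poly intr (P s o)).[v ^- 2].

Definition neg_part (P : 'S_n -> 'S_n -> {poly int}) s o : laurent :=
  v ^ ((ninv s)%:Z - (ninv o)%:Z) * (map_poly intr (P s o)).[v ^+ 2].

Lemma bar_pos_part (bar : {rmorphism H -> H}) P s o : is_bar bar ->
  bar (pos_part P s o)%:A = (neg_part P s o)%:A.
Proof.
(* On scalars [bar] is a ring morphism sending [v] to its inverse, so the two sides can be compared
   factor by factor. *)
case=> barv _; pose g : {rmorphism laurent -> H} := bar \o in_alg H.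
rewrite -[LHS]/(g _) -[RHS]/(in_alg H _).
have gv : g v = in_alg H v^-1 by [].
have vU : v \is a GRing.unit := v_unit.
have vVU : v^-1 \is a GRing.unit by rewrite unitrV.
have gvV : g v^-1 = in_alg H v by rewrite rmorphV // gv -rmorphV // invrK.
rewrite /pos_part /neg_part !horner_intr !rmorphM !rmorph_sum; congr (_ * _).
  by rewrite rmorphXz // gv -rmorphXz // exprz_inv opprB.
apply: eq_bigr => i _; rewrite !rmorphM !rmorph_int; congr (_ * _).
by rewrite -exprVn rmorphXn rmorphXn gvV !rmorphXn.
Qed.

(** The bar-invariant element is expanded over [hbar] in two ways: by applying [bar], and by
    substituting [h_hbar] for each [h s]. *)
Lemma KL_relation P x o : is_KL_family H P ->
  neg_part P x o = \sum_s pos_part P s o * R x s.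
Proof.
case=> _ _ _ [bar barP barKL]; have [_ barh] := barP.
have KLE : KL_element H P o = \sum_s pos_part P s o *: h s.
  by apply: eq_bigr => s _; rewrite !len_Sigma.
have E1 : KL_element H P o = \sum_s neg_part P s o *: hbar s.
  rewrite -[LHS]barKL KLE rmorph_sum; apply: eq_bigr => s _.
  by rewrite -[_ *: h s]mulr_algl rmorphM bar_pos_part // barh mulr_algl.
have E2 : KL_element H P o = \sum_x (\sum_s pos_part P s o * R x s) *: hbar x.
  rewrite KLE; under eq_bigr => s _ do rewrite h_hbar scaler_sumr.
  rewrite exchange_big; apply: eq_bigr => y _; rewrite scaler_suml.
  by apply: eq_bigr => s _; rewrite scalerA.
exact: (hbar_free (etrans (esym E1) E2) x).
Qed.

Lemma Rt_refl x : R x x = 1.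
Proof.
elim: (tlist n 0) (@tlist_reflections n 0) => [|t L IHL] sub /=; first by rewrite eqxx.
have subL : {subset L <= reflections (Sigma n)}.
  by move=> t' t'L; apply: sub; rewrite inE t'L orbT.
rewrite IHL //; case: ifP => [lt|]; rewrite ?addr0 // Rt_eq0 ?mulr0 ?addr0 //.
by apply: contraL lt => /le_ninv; rewrite -leqNgt.
Qed.

(** The term at [x] moves to the left; the others vanish unless [x <= y <= o]. Summing over the
    interval from the fixed [s] lets one isomorphism serve every [x]. *)
Lemma KL_recursion P s x o : is_KL_family H P -> bruhat_le (Sigma n) s x ->
  neg_part P x o - pos_part P x o =
  \sum_(y : {z : 'S_n | bruhat_le (Sigma n) s z && bruhat_le (Sigma n) z o} |
      val y != x) pos_part P (val y) o * R x (val y).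
Proof.
move=> KL sx; rewrite (KL_relation _ _ KL) (bigD1 x) //= Rt_refl mulr1 addrAC subrr add0r.
have [P0 _ _ _] := KL.
rewrite (bigID (fun y => bruhat_le (Sigma n) x y && bruhat_le (Sigma n) y o)) /=.
rewrite [X in _ + X]big1 ?addr0 => [|y]; last first.
  case/andP=> _; rewrite negb_and => /orP[xy|yo].
    by rewrite Rt_eq0 ?mulr0 //; apply: tlist_reflections.
  by rewrite /pos_part P0 // rmorph0 horner0 mulr0 mul0r.
rewrite (reindex_omap (val : {z : 'S_n | bruhat_le (Sigma n) s z &&
    bruhat_le (Sigma n) z o} -> 'S_n) insub); last first.
  by move=> y /and3P[_ xy yo]; rewrite insubT //= yo (le_trans sx xy).
rewrite [RHS](bigID (fun y => bruhat_le (Sigma n) x (val y))) /=.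
rewrite [X in _ = _ + X]big1 ?addr0 => [|y /andP[_ xy]]; last first.
  by rewrite Rt_eq0 ?mulr0 //; apply: tlist_reflections.
by apply: eq_bigl => y; rewrite valK eqxx andbT; case/andP: (valP y) => _ ->; rewrite andbT.
Qed.

End BarBasis.

(** * Invariance of Kazhdan-Lusztig polynomials *)

Section KLInvariance.

Local Open Scope ring_scope.

Variables (n1 n2 : nat) (s1 o1 : 'S_n1) (s2 o2 : 'S_n2).
Variables (H1 : heckeAlgebra (Sigma n1)) (H2 : heckeAlgebra (Sigma n2)).
Variables (P1 : 'S_n1 -> 'S_n1 -> {poly int}) (P2 : 'S_n2 -> 'S_n2 -> {poly int}).
Hypotheses (KL1 : is_KL_family H1 P1) (KL2 : is_KL_family H2 P2).

Local Notation I1 := (bruhat_interval (Sigma n1) s1 o1).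
Local Notation I2 := (bruhat_interval (Sigma n2) s2 o2).

Variable phi : I1 -> I2.
Hypothesis phi_iso : digraph_iso (@bruhat_interval_edge _ (Sigma n1) s1 o1)
  (@bruhat_interval_edge _ (Sigma n2) s2 o2) phi.
Hypothesis phi_R : forall x w : I1,
  Rt (v^-1 - v) (tlist n1 0) (val x) (val w) =
  Rt (v^-1 - v) (tlist n2 0) (val (phi x)) (val (phi w)).

Lemma subz_nat (a b : nat) : (a <= b)%N -> b%:Z - a%:Z = (b - a)%N%:Z.
Proof. lia. Qed.

(** Downward induction from [o1]: the right sides of [KL_recursion] agree term by term, and under
    the degree bound the left side determines the polynomial by [self_dual_inj]. *)
Lemma KL_invariance (x : I1) : P1 (val x) o1 = P2 (val (phi x)) o2.
Proof.
have [m] := ubnP (ninv o1 - ninv (val x))%N; elim: m x => // m IHm x xm.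
have [_ P1oo deg1 _] := KL1; have [_ P2oo deg2 _] := KL2.
have [xo|nxo] := eqVneq (val x) o1.
  by rewrite (phi_max phi_iso xo) P2oo; apply: etrans (congr1 (P1^~ o1) xo) (P1oo _).
have [[psi phiK psiK] phiE] := phi_iso.
have nphixo : val (phi x) != o2.
  apply: contra nxo => /eqP xo; apply/eqP; rewrite -[x]phiK.
  apply: (@phi_max _ _ s2 o2 s1 o1 psi); last exact: xo.
  by split; [exists phi | move=> z z'; rewrite phiE !psiK].
have x_o := itv_upper x; have phix_o := itv_upper (phi x).
have corank := phi_corank x phi_iso.
have lx := le_ninv x_o; have lphix := le_ninv phix_o.
apply: (@self_dual_inj _ _ (ninv o1 - ninv (val x))%N).
- by rewrite -!len_Sigma; apply: deg1.
- by rewrite corank -!len_Sigma; apply: deg2.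
have E1 := KL_recursion o1 KL1 (itv_lower x).
have E2 := KL_recursion o2 KL2 (itv_lower (phi x)).
move: E1 E2; rewrite /neg_part /pos_part.
rewrite !(subz_nat lx) !(subz_nat lphix) -![_%:Z - (ninv o1)%:Z]opprB -![_%:Z - (ninv o2)%:Z]opprB.
rewrite !(subz_nat lx) !(subz_nat lphix) -corank => -> ->.
rewrite [RHS](reindex phi) /=; last by apply: onW_bij; exists psi.
apply: eq_big => [y|y ny].
  congr (~~ _); apply/eqP/eqP => [/val_inj->//|/val_inj/(can_inj phiK)->//].
(* Terms at [y] not above [x] vanish; the others lie strictly above [x], where the induction
   hypothesis applies. *)
rewrite phi_R; case: (boolP (bruhat_le (Sigma n1) (val x) (val y))) => [xy|nxy]; last first.
  by rewrite -phi_R Rt_eq0 ?mulr0 //; apply: tlist_reflections.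
have yo : (ninv (val y) <= ninv o1)%N := le_ninv (itv_upper y).
have phiyo : (ninv (val (phi y)) <= ninv o2)%N := le_ninv (itv_upper (phi y)).
have xyn : (ninv (val x) < ninv (val y))%N.
  by rewrite ltnNge; apply: contra ny => /(le_ninv_eq xy) ->.
rewrite (subz_nat yo) (subz_nat phiyo) (phi_corank y phi_iso) IHm //.
have aux (a b c k : nat) : (a < b -> b <= c -> c - a < k.+1 -> c - b < k)%N by lia.
exact: aux xyn yo xm.
Qed.

End KLInvariance.

(** * The standard filtration and its colouring *)

Section Standard.

Variable n : nat.
Implicit Types t : 'S_n.

Lemma mem_gen_simples_hi m (x y : 'S_n) : bruhat_edge (Sigma n) x y ->
  (label x y \in <<simples n m>>%g) = (hi (label x y) < m).
Proof.
case/edgeP => a [b [ab _ ->]]; rewrite label_mul hi_tperm //.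
apply/mem_gen_simples/idP => [fix_ab|bm i mi].
  rewrite ltnNge; apply/negP => /fix_ab; rewrite tpermR => E.
  by move: ab; rewrite E ltnn.
by rewrite tpermD // -(inj_eq val_inj) /=; lia.
Qed.

Lemma simples_proper m : m.+1 < n -> simples n m.+1 \proper simples n m.+2.
Proof.
move=> mn; apply/properP; split.
  apply/subsetP => w /simplesP[a [b [ab bm ->]]]; apply/simplesP.
  by exists a, b; split=> //; apply: ltnW.
exists (tperm (Ordinal (ltnW mn)) (Ordinal mn)).
  by apply/simplesP; exists (Ordinal (ltnW mn)), (Ordinal mn).
apply/negP => /simplesP[a [b [ab bm /(congr1 (@hi n))]]].
rewrite !hi_tperm /= -?ab // => E; move: bm; rewrite -ab -E; lia.
Qed.

Lemma simples0 : simples n 1 = set0.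
Proof. by apply/setP => w; rewrite inE; apply/negP => /simplesP[a [b [ab]]]; lia. Qed.

Lemma simples_predn : simples n n.-1.+1 = Sigma n.
Proof.
rewrite -simples_full; apply/setP => w.
by apply/simplesP/simplesP => -[a [b [ab bm ->]]]; exists a, b; split=> //; have := ltn_ord b; lia.
Qed.

Lemma simples_predn_proper i : i < n.-1 -> simples n i.+1 \proper simples n i.+2.
Proof. by move=> i_n; apply: simples_proper; lia. Qed.

(** The shift [i.+1] puts s_1, ..., s_i at level [i]; with positions counted from 0, the colour of
    [(a b)], [a < b], is then exactly [b]. *)
Definition std_filtration : filtration (Sigma n) :=
  @Filtration _ (Sigma n) n.-1 (fun i => simples n i.+1)
    simples0 simples_predn simples_predn_proper.

Lemma coloring_std (x y : 'S_n) : bruhat_edge (Sigma n) x y ->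
  coloring std_filtration (label x y) = hi (label x y).
Proof.
move=> xy; have hn := label_hi xy; apply: find_iota => /= [||j jk].
- lia.
- by rewrite mem_gen_simples_hi.
- by rewrite mem_gen_simples_hi //; lia.
Qed.

End Standard.

(** Disposes of the case where [s1 <= o1] fails: then both intervals are empty and both polynomials
    compared are 0. *)
Lemma interval_nonempty n1 n2 (s1 o1 : 'S_n1) (s2 o2 : 'S_n2)
    (phi : bruhat_interval (Sigma n1) s1 o1 -> bruhat_interval (Sigma n2) s2 o2) :
  bijective phi -> bruhat_le (Sigma n1) s1 o1 = bruhat_le (Sigma n2) s2 o2.
Proof.
case=> psi _ _; apply/idP/idP => le.
  have I : bruhat_le (Sigma n1) s1 s1 && bruhat_le (Sigma n1) s1 o1.
    by rewrite le andbT; apply: connect0.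
  by case: (phi (exist _ s1 I)) => z /andP[]; apply: le_trans.
have I : bruhat_le (Sigma n2) s2 s2 && bruhat_le (Sigma n2) s2 o2.
  by rewrite le andbT; apply: connect0.
by case: (psi (exist _ s2 I)) => z /andP[]; apply: le_trans.
Qed.

Theorem theorem1p4 :
  (exists2 JJ : forall n : nat, {set 'S_n},
    forall n : nat, 1 < n -> JJ n \proper Sigma n &
    forall (n1 n2 : nat), 1 < n1 -> 1 < n2 ->
    forall (H1 : heckeAlgebra (Sigma n1)) (H2 : heckeAlgebra (Sigma n2))
      (s1 o1 : 'S_n1) (s2 o2 : 'S_n2)
      (phi : bruhat_interval (Sigma n1) s1 o1 -> bruhat_interval (Sigma n2) s2 o2),
    digraph_iso (@bruhat_interval_edge _ (Sigma n1) s1 o1)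
      (@bruhat_interval_edge _ (Sigma n2) s2 o2) phi ->
    (forall z z' : bruhat_interval (Sigma n1) s1 o1, bruhat_interval_edge z z' ->
      (edge_reflection z z' \in <<JJ n1>>%g) =
      (edge_reflection (phi z) (phi z') \in <<JJ n2>>%g)) ->
    Rpoly H1 (JJ n1) s1 o1 = Rpoly H2 (JJ n2) s2 o2)
  /\
  (exists F : forall n : nat, filtration (Sigma n),
    forall (n1 n2 : nat), 0 < n1 -> 0 < n2 ->
    forall (H1 : heckeAlgebra (Sigma n1)) (H2 : heckeAlgebra (Sigma n2))
      (P1 : 'S_n1 -> 'S_n1 -> {poly int}) (P2 : 'S_n2 -> 'S_n2 -> {poly int}),
    is_KL_family H1 P1 -> is_KL_family H2 P2 ->
    forall (s1 o1 : 'S_n1) (s2 o2 : 'S_n2)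
      (phi : bruhat_interval (Sigma n1) s1 o1 -> bruhat_interval (Sigma n2) s2 o2)
      (gamma : nat -> nat),
    digraph_iso (@bruhat_interval_edge _ (Sigma n1) s1 o1)
      (@bruhat_interval_edge _ (Sigma n2) s2 o2) phi ->
    (forall i : nat, 1 <= i <= filt_size (F n1) ->
      1 <= gamma i <= filt_size (F n2)) ->
    (forall i j : nat, 1 <= i -> i < j -> j <= filt_size (F n1) ->
      gamma i < gamma j) ->
    (forall z z' : bruhat_interval (Sigma n1) s1 o1, bruhat_interval_edge z z' ->
      gamma (coloring (F n1) (edge_reflection z z')) =
      coloring (F n2) (edge_reflection (phi z) (phi z'))) ->
    P1 s1 o1 = P2 s2 o2).
Proof.
split.
  exists (fun n => simples n n.-1) => [n n1|n1 n2 n1_gt1 n2_gt1 H1 H2 s1 o1 s2 o2 phi phi_iso phiJ].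
    rewrite -simples_predn; have := @simples_predn_proper n n.-2.
    by rewrite (_ : n.-2.+1 = n.-1) //; [apply|]; lia.
  rewrite !Rpoly_Rt ?leq_pred //.
  have [so|nso] := boolP (bruhat_le (Sigma n1) s1 o1); last first.
    rewrite !Rt_eq0 ?mulr0 //; try exact: tlist_reflections.
    by rewrite -(interval_nonempty (proj1 phi_iso)).
  have Is : bruhat_le (Sigma n1) s1 s1 && bruhat_le (Sigma n1) s1 o1.
    by rewrite so andbT; apply: connect0.
  have Io : bruhat_le (Sigma n1) s1 o1 && bruhat_le (Sigma n1) o1 o1.
    by rewrite so; apply: connect0.
  have phi_s : val (phi (exist _ s1 Is)) = s2 by apply: phi_min.
  have phi_o : val (phi (exist _ o1 Io)) = o2 by apply: phi_max.
  have phi_hi x y : bruhat_interval_edge x y ->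
      (n1.-1 <= hi (edge_reflection x y)) =
      (n2.-1 <= hi (edge_reflection (phi x) (phi y))).
    move=> xy; have := phiJ _ _ xy; rewrite (mem_gen_simples_hi _ xy) mem_gen_simples_hi.
      by move=> E; rewrite leqNgt E -leqNgt.
    by rewrite -[bruhat_edge _ _ _]/(bruhat_interval_edge _ _) -(proj2 phi_iso).
  have := phi_Rt phi_iso phi_hi _ (v^-1 - v)%R (exist _ s1 Is) (exist _ o1 Io).
  rewrite phi_s phi_o => -> => [|x y x' y' xy xy' kxy kxy']; last first.
    have xy2 : bruhat_interval_edge (phi x) (phi y) by rewrite -(proj2 phi_iso).
    have xy2' : bruhat_interval_edge (phi x') (phi y') by rewrite -(proj2 phi_iso).
    (* No colour exceeds [n.-1], so labels reaching the threshold are never strictly ordered by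
       [hi], on either side. *)
    have top (n a b : nat) : n.-1 <= a -> 0 < b < n -> (a < b) = false by lia.
    rewrite (top _ _ _ kxy (label_hi xy')) (top n2) //; last exact: label_hi xy2'.
    by rewrite -phi_hi.
  (* The powers of [v] agree because [phi] preserves the length difference between bottom and
     top. *)
  congr (v ^ _ * _)%R; have := phi_corank (exist _ s1 Is) phi_iso; rewrite phi_s /=.
  have := le_ninv so; rewrite (interval_nonempty (proj1 phi_iso)) in so.
  by have := le_ninv so; lia.
exists std_filtration => n1 n2 n1_gt0 n2_gt0 H1 H2 P1 P2 KL1 KL2 s1 o1 s2 o2 phi gamma.
move=> phi_iso _ gamma_incr phi_gamma.
have [so|nso] := boolP (bruhat_le (Sigma n1) s1 o1); last first.
  case: KL1 => -> // _ _ _; case: KL2 => -> //.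
  by rewrite -(interval_nonempty (proj1 phi_iso)).
have Is : bruhat_le (Sigma n1) s1 s1 && bruhat_le (Sigma n1) s1 o1.
  by rewrite so andbT; apply: connect0.
have phi_s : val (phi (exist _ s1 Is)) = s2 by apply: phi_min.
rewrite -phi_s; apply: (KL_invariance KL1 KL2 phi_iso _ (exist _ s1 Is)).
(* With both thresholds 0 every label counts; [gamma], strictly increasing on the colours, preserves
   and reflects their order. *)
apply: (phi_Rt phi_iso (k1 := 0) (k2 := 0)) => // x y x' y' xy xy' _ _.
have E z z' : bruhat_interval_edge z z' ->
    hi (edge_reflection (phi z) (phi z')) = gamma (hi (edge_reflection z z')).
  move=> zz'; have zz2 : bruhat_interval_edge (phi z) (phi z') by rewrite -(proj2 phi_iso).
  by rewrite -[LHS](coloring_std zz2) -[in RHS](coloring_std zz') -phi_gamma.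
rewrite !E //; have /andP[h0 hn] := label_hi xy; have /andP[h0' hn'] := label_hi xy'.
have mono i j : 0 < i -> i < j -> j < n1 -> gamma i < gamma j.
  by move=> i0 ij jn; apply: gamma_incr => //=; lia.
case: ltngtP => [lt|lt|->]; last by rewrite ltnn.
  by rewrite mono.
by apply/esym/negbTE; rewrite -leqNgt ltnW // mono.
Qed.
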